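(* Let $T>0$ and let $h,b\colon\mathbb{R}\to\mathbb{R}$ satisfy (A1) and (A2). If $p\in L^{4}(0,T;L^2(0,1))$ and $v_0\in L^2(0,1)$, then the problem (P)($p,v_0$) has at most one weak solution.
   Context: Put $Q(T)=(0,T)\times(0,1)$, $H=L^2(0,1)$, $X=H^1(0,1)$. Assumption (A1): $h\in C^2(\mathbb{R})$ with $\delta_h\le h'\le C_h$ and $|h''|\le C_h$ on $\mathbb{R}$, for positive constants $\delta_h,C_h$. Assumption (A2): $b\in C^2(\mathbb{R})$ with $\delta_b\le b\le C_b$ and $|b'|,|b''|\le C_b$ on $\mathbb{R}$, for positive constants $\delta_b,C_b$. The problem (P)($p,v_0$) is $\partial_t h(v)=\partial_x(\partial_x v+b(v)p)$ in $Q(T)$, $\partial_x v+b(v)p=0$ at $x=0,1$ for $0<t<T$, $v(0,x)=v_0(x)$ for $x\in(0,1)$, where $p\colon(0,T)\times[0,1]\to\mathbb{R}$ is given. A weak solution of (P)($p,v_0$) is a function $v\colon[0,T)\times(0,1)\to\mathbb{R}$ with $v\in L^\infty(0,T;H)\cap L^2(0,T;X)$ such that $$-\int_{Q(T)}h(v)\,\partial_t\eta\,dx\,dt+\int_{Q(T)}(\partial_x v+b(v)p)\,\partial_x\eta\,dx\,dt=\int_0^1 h(v_0(x))\eta(0,x)\,dx$$ for every $\eta\in W^{1,2}(0,T;H)\cap L^2(0,T;X)$ with $\eta(T,\cdot)=0$. *)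

(* Defs.v *)
From mathcomp Require Import all_boot all_order all_algebra.
From mathcomp Require Import all_classical all_reals all_analysis.
Set Implicit Arguments. Unset Strict Implicit. Unset Printing Implicit Defensive.
Import Order.TTheory GRing.Theory Num.Theory numFieldNormedType.Exports.
Local Open Scope classical_set_scope.
Local Open Scope ring_scope.

Section PDE_defs.
Context {R : realType}.

Notation leb := (@lebesgue_measure R).
Notation leb2 := ((@lebesgue_measure R) \x (@lebesgue_measure R))%E.

Definition I01 : set R := `]0, 1[.
Definition I0T (T : R) : set R := `]0, T[.
Definition QT (T : R) : set (R * R) := I0T T `*` I01.

Definition C2 (f : R -> R) : Prop :=
  (forall x, derivable f x 1) /\ (forall x, derivable (derive1 f) x 1) /\
  continuous (derive1 (derive1 f)).

Definition A1 (h : R -> R) : Prop :=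
  C2 h /\ exists dh Ch : R, 0 < dh /\ 0 < Ch /\
    forall x, dh <= derive1 h x <= Ch /\ `|derive1 (derive1 h) x| <= Ch.

Definition A2 (b : R -> R) : Prop :=
  C2 b /\ exists db Cb : R, 0 < db /\ 0 < Cb /\
    forall x, db <= b x <= Cb /\ `|derive1 b x| <= Cb /\ `|derive1 (derive1 b) x| <= Cb.

Definition L2_01 (f : R -> R) : Prop :=
  measurable_fun I01 f /\ (\int[leb]_(x in I01) ((f x) ^+ 2)%:E < +oo)%E.

Definition L2_Q (T : R) (u : R -> R -> R) : Prop :=
  measurable_fun (QT T) (fun z : R * R => u z.1 z.2) /\
  (\int[leb2]_(z in QT T) ((u z.1 z.2) ^+ 2)%:E < +oo)%E.

Definition Linf_H (T : R) (u : R -> R -> R) : Prop :=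
  measurable_fun (QT T) (fun z : R * R => u z.1 z.2) /\
  exists M : R, {ae leb, forall t, I0T T t ->
     (\int[leb]_(x in I01) ((u t x) ^+ 2)%:E <= M%:E)%E}.

Definition L4_L2 (T : R) (p : R -> R -> R) : Prop :=
  measurable_fun (QT T) (fun z : R * R => p z.1 z.2) /\
  (\int[leb]_(t in I0T T)
      ((\int[leb]_(x in I01) ((p t x) ^+ 2)%:E) *
       (\int[leb]_(x in I01) ((p t x) ^+ 2)%:E)) < +oo)%E.

Definition Cc_inf_01 (phi : R -> R) : Prop :=
  (forall n x, derivable (derive1n n phi) x 1) /\
  exists a c : R, 0 < a /\ a < c /\ c < 1 /\
    forall x, (x < a \/ c < x) -> phi x = 0.

(* w is the weak x-derivative of u and w in L^2(Q(T)); together with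
   L2_Q T u this expresses u in L^2(0,T;X), X = H^1(0,1), with
   partial_x u = w : for a.e. t, w(t) is the weak derivative of u(t). *)
Definition weak_dx (T : R) (u w : R -> R -> R) : Prop :=
  L2_Q T w /\
  {ae leb, forall t, I0T T t ->
     forall phi : R -> R, Cc_inf_01 phi ->
       (\int[leb]_(x in I01) (u t x * derive1 phi x)%:E =
        - \int[leb]_(x in I01) (w t x * phi x)%:E)%E}.

(* eta in W^{1,2}(0,T;H) /\ L^2(0,T;X) with eta(T,.) = 0, where eta_t is its
   time derivative and eta_x its space derivative.  eta(t,.) is the
   (absolutely) continuous H-valued representative on [0,T]:
   eta(t) = eta(0) + int_0^t eta_t(s) ds in H for every t in [0,T]. *)
Definition test_fun (T : R) (eta eta_t eta_x : R -> R -> R) : Prop :=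
  L2_Q T eta /\ L2_Q T eta_t /\ weak_dx T eta eta_x /\ L2_01 (eta 0) /\
  (forall t, 0 <= t <= T ->
     {ae leb, forall x, I01 x ->
        eta t x = eta 0 x + Rintegral leb [set` `[0, t]%R] (fun s => eta_t s x)}) /\
  {ae leb, forall x, I01 x -> eta T x = 0}.

Definition weak_solution (T : R) (h b : R -> R) (p : R -> R -> R)
    (v0 : R -> R) (v : R -> R -> R) : Prop :=
  Linf_H T v /\ L2_Q T v /\
  exists vx : R -> R -> R, weak_dx T v vx /\
    forall eta eta_t eta_x : R -> R -> R, test_fun T eta eta_t eta_x ->
      - Rintegral leb2 (QT T) (fun z => h (v z.1 z.2) * eta_t z.1 z.2)
      + Rintegral leb2 (QT T)
          (fun z => (vx z.1 z.2 + b (v z.1 z.2) * p z.1 z.2) * eta_x z.1 z.2)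
      = Rintegral leb I01 (fun x => h (v0 x) * eta 0 x).

End PDE_defs.

(* Main.v *)
(** Write w = v1 - v2, U = h(v1) - h(v2), F = w_x + (b(v1) - b(v2)) p and
    G(t,x) = \int_0^t F(s,x) ds.  All these functions are in L^2(Q(T)).  If k is
    the weak x-derivative of g, testing both equations with
    eta(t) = - \int_t^T g ds, so that eta_t = g and eta_x = - \int_t^T k ds, gives
      \iint U g + \iint G k = 0.
    With g = - \int_x^1 k dy and k arbitrary this says G(t,x) = \int_0^x U(t,y) dy,
    whence |G(t,.)|_oo^2 <= 2 |G(t)| |U(t)|, norms without index being those of
    L^2(0,1).  With g = w 1_{s < t} it turns the identity
    |G(t)|^2 / 2 = \iint_{s < t} F G into
      |G(t)|^2 / 2 = - \iint_{s < t} U w + \iint_{s < t} (b(v1) - b(v2)) p G.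
    The last integrand is bounded in x-integral by
    C |w| |p| |G|_oo <= C' |w|^{3/2} |p| |G|^{1/2}, which Young's inequality absorbs
    into \int U w >= dl |w|^2 up to C'' |p|^4 |G|^2; since |p|^4 is integrable in
    time, Gronwall's lemma yields G = 0, and then w = 0. *)
Require Import Defs.
From mathcomp Require Import all_boot all_order all_algebra.
From mathcomp Require Import all_classical all_reals all_analysis.
From mathcomp Require Import measurable_realfun.
From mathcomp Require Import ring lra.
Set Implicit Arguments. Unset Strict Implicit. Unset Printing Implicit Defensive.
Import Order.TTheory GRing.Theory Num.Theory numFieldNormedType.Exports.
Local Open Scope classical_set_scope.
Local Open Scope ring_scope.

(** * Real-valued integrals over a measure space *)

(** The difference w has no time derivative to work with, so neither w nor 1_{s<t} w can serve as a
    test function; they enter only as eta_t, and integrating backwards from T makes eta(T) = 0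
    automatic. The initial-data terms are the same number in both equations and cancel. All
    functions are extended by zero outside Q(T), so that primitives in time and in space become
    integral operators on the whole line with kernel 1_{s<t}; integration by parts against such
    primitives is then Fubini's theorem, the adjoint having the transposed kernel. The time
    derivative of |G|^2 / 2 is likewise avoided, by splitting the square of an integral along the
    diagonal. As for the exponent 4: |G|_oo contributes |U|^{1/2} <= C |w|^{1/2}, which with |w|
    makes |w|^{3/2}, and Young's inequality with exponents 4/3 and 4 leaves |w|^2 and (|p|
    |G|^{1/2})^4 = |p|^4 |G|^2. This is linear in |G|^2, as Gronwall's lemma requires, with a
    coefficient that is merely integrable in time. *)

Local Notation L1 mu f := (integrable mu setT (EFin \o f)).
Local Notation meas f := (measurable_fun setT f).

Section real_integral.
Context d (T : measurableType d) (R : realType) (mu : {measure set T -> \bar R}).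
Implicit Types f g : T -> R.

Lemma L1_meas f : L1 mu f -> meas f.
Proof. by move=> /measurable_int/measurable_EFinP. Qed.

Lemma L1_EFin f : L1 mu f -> (\int[mu]_x (f x)%:E)%E = (\int[mu]_x f x)%:E.
Proof. by move=> i; rewrite /Rintegral fineK//; exact: integrable_fin_num. Qed.

Lemma L1_dom f g : meas f -> (forall x, `|f x| <= g x) -> L1 mu g -> L1 mu f.
Proof.
move=> mf fg; apply: le_integrable => //; first exact/measurable_EFinP.
by move=> x _ /=; rewrite lee_fin (le_trans (fg x))// ler_norm.
Qed.

Lemma L1_dom_ae f g : meas f -> {ae mu, forall x, `|f x| <= g x} ->
  L1 mu g -> L1 mu f.
Proof.
move=> mf fg /integrableP[mg ig]; apply/integrableP; split.
  exact/measurable_EFinP.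
apply: le_lt_trans ig; apply: ae_ge0_le_integral => //.
- by apply/measurable_EFinP; exact: measurableT_comp.
- exact: measurableT_comp.
- by apply: filterS fg => x fg _ /=; rewrite lee_fin (le_trans fg)// ler_norm.
Qed.

Lemma L1D f g : L1 mu f -> L1 mu g -> L1 mu (fun x => f x + g x).
Proof. by move=> i j; have := integrableD measurableT i j. Qed.

Lemma L1B f g : L1 mu f -> L1 mu g -> L1 mu (fun x => f x - g x).
Proof. by move=> i j; have := integrableB measurableT i j. Qed.

Lemma L1Z r f : L1 mu f -> L1 mu (fun x => r * f x).
Proof. by move=> i; have := integrableZl measurableT r i. Qed.

Lemma L1N f : L1 mu f -> L1 mu (fun x => - f x).
Proof. by move=> i; have := integrableN i. Qed.

Lemma L1_norm f : L1 mu f -> L1 mu (fun x => `|f x|).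
Proof. by move=> i; have := integrable_norm i. Qed.

Lemma RintD f g : L1 mu f -> L1 mu g ->
  \int[mu]_x (f x + g x) = \int[mu]_x f x + \int[mu]_x g x.
Proof. exact: RintegralD. Qed.

Lemma RintB f g : L1 mu f -> L1 mu g ->
  \int[mu]_x (f x - g x) = \int[mu]_x f x - \int[mu]_x g x.
Proof. exact: RintegralB. Qed.

Lemma RintZ r f : L1 mu f -> \int[mu]_x (r * f x) = r * \int[mu]_x f x.
Proof. exact: RintegralZl. Qed.

Lemma RintN f : L1 mu f -> \int[mu]_x (- f x) = - \int[mu]_x f x.
Proof.
move=> i; rewrite -mulN1r -RintZ//.
by apply: eq_Rintegral => x _; rewrite mulN1r.
Qed.

Lemma Rint_ge0 f : (forall x, 0 <= f x) -> 0 <= \int[mu]_x f x.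
Proof. by move=> f0; apply: Rintegral_ge0 => x _. Qed.

Lemma Rint_le f g : L1 mu f -> L1 mu g -> (forall x, f x <= g x) ->
  \int[mu]_x f x <= \int[mu]_x g x.
Proof. by move=> i j fg; apply: le_Rintegral => // x _. Qed.

Lemma Rint_eq f g : f =1 g -> \int[mu]_x f x = \int[mu]_x g x.
Proof. by move=> fg; apply: eq_Rintegral => x _. Qed.

Lemma Rint_ae_eq f g : meas f -> meas g -> {ae mu, forall x, f x = g x} ->
  \int[mu]_x f x = \int[mu]_x g x.
Proof.
move=> mf mg fg; congr fine; apply: ae_eq_integral => //.
- exact/measurable_EFinP.
- exact/measurable_EFinP.
- by apply: filterS fg => x /= -> _.
Qed.

(** Replacing [g] by max(f, g), which equals [g] almost everywhere, reduces this to an inequality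
    valid everywhere. *)
Lemma Rint_ae_le f g : L1 mu f -> L1 mu g -> {ae mu, forall x, f x <= g x} ->
  \int[mu]_x f x <= \int[mu]_x g x.
Proof.
move=> i j fg.
have mf := L1_meas i; have mg := L1_meas j.
have mm : meas (fun x => Num.max (f x) (g x)) by exact: measurable_maxr.
have im : L1 mu (fun x => Num.max (f x) (g x)).
  apply: (@L1_dom _ (fun x => `|f x| + `|g x|)) => //.
    move=> x; rewrite /Num.max; case: ifP => _.
      by rewrite lerDr.
    by rewrite lerDl.
  by apply: L1D; exact: L1_norm.
have -> : \int[mu]_x g x = \int[mu]_x Num.max (f x) (g x).
  by apply: Rint_ae_eq => //; apply: filterS fg => x ?; rewrite max_r.
by apply: Rint_le => // x; rewrite le_max lexx.
Qed.

Lemma Rint_eq0_ae f : L1 mu f -> (forall x, 0 <= f x) -> \int[mu]_x f x = 0 ->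
  {ae mu, forall x, f x = 0}.
Proof.
move=> i f0 e.
have : (\int[mu]_x `|(EFin \o f) x| = 0)%E.
  rewrite -[RHS]/(0%:E) -e -L1_EFin//; apply: eq_integral => x _ /=.
  by rewrite ger0_norm.
move/(ae_eq_integral_abs mu measurableT (measurable_int mu i)) => H.
by apply: filterS H => x /(_ I) []. 
Qed.

Lemma Rint_const0 : \int[mu]_x (0 : R) = 0.
Proof. by rewrite /Rintegral integral0. Qed.

Lemma Rint_eq0 f : (forall x, f x = 0) -> \int[mu]_x f x = 0.
Proof. by move=> f0; rewrite (Rint_eq f0) Rint_const0. Qed.

Lemma ae_imp (P Q : T -> Prop) : {ae mu, forall x, P x} ->
  (forall x, P x -> Q x) -> {ae mu, forall x, Q x}.
Proof. by move=> aeP PQ; apply: filterS aeP => x; exact: PQ. Qed.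

Lemma ae_imp2 (P1 P2 Q : T -> Prop) : {ae mu, forall x, P1 x} ->
  {ae mu, forall x, P2 x} -> (forall x, P1 x -> P2 x -> Q x) ->
  {ae mu, forall x, Q x}.
Proof. by move=> ae1 ae2 PQ; apply: filterS2 ae1 ae2 => x; exact: PQ. Qed.

End real_integral.

(** * Square-integrable functions and the Cauchy-Schwarz inequality *)

Section square_integrable.
Context d (T : measurableType d) (R : realType) (mu : {measure set T -> \bar R}).
Implicit Types f g : T -> R.

Definition L2 f := meas f /\ L1 mu (fun x => f x ^+ 2).

Lemma L2M f g : L2 f -> L2 g -> L1 mu (fun x => f x * g x).
Proof.
move=> [mf f2] [mg g2]; apply: (@L1_dom _ _ _ _ _ (fun x => f x ^+ 2 + g x ^+ 2)).
- exact: measurable_funM.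
- move=> x; rewrite normrM -(real_normK (num_real (f x))).
  by rewrite -(real_normK (num_real (g x))); nra.
- exact: L1D.
Qed.

Lemma L2_dom C f g : meas f -> (forall x, `|f x| <= C * `|g x|) -> L2 g -> L2 f.
Proof.
move=> mf fg [mg g2]; split => //.
apply: (@L1_dom _ _ _ _ _ (fun x => C ^+ 2 * g x ^+ 2)); last exact: L1Z.
  exact: measurable_funX.
move=> x; rewrite ger0_norm ?sqr_ge0// -[f x ^+ 2]real_normK ?num_real//.
rewrite -[g x ^+ 2]real_normK ?num_real// -exprMn.
by rewrite ler_pXn2r// nnegrE (le_trans _ (fg x)).
Qed.

Lemma L2Z r f : L2 f -> L2 (fun x => r * f x).
Proof.
move=> i; apply: (@L2_dom `|r| _ f) => //; last by move=> x; rewrite normrM.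
by apply: measurable_funM => //; case: i.
Qed.

Lemma L2N f : L2 f -> L2 (fun x => - f x).
Proof.
move=> [mf f2]; split; first exact: measurableT_comp.
by under eq_fun do rewrite sqrrN.
Qed.

Lemma L2D f g : L2 f -> L2 g -> L2 (fun x => f x + g x).
Proof.
move=> [mf f2] [mg g2]; split; first exact: measurable_funD.
apply: (@L1_dom _ _ _ _ _ (fun x => 2 * f x ^+ 2 + 2 * g x ^+ 2)).
- by apply: measurable_funX; exact: measurable_funD.
- by move=> x; rewrite ger0_norm ?sqr_ge0//; have := sqr_ge0 (f x - g x); nra.
- by apply: L1D; exact: L1Z.
Qed.

Lemma L2B f g : L2 f -> L2 g -> L2 (fun x => f x - g x).
Proof. by move=> i j; apply: L2D => //; exact: L2N. Qed.

Lemma L2_indic A : measurable A -> (mu A < +oo)%E -> L2 \1_A.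
Proof.
move=> mA A_fin; split; first exact: measurable_indic.
rewrite (_ : (fun x => \1_A x ^+ 2) = (\1_A : T -> R)).
  apply/integrableP; split; first exact/measurable_EFinP/measurable_indic.
  rewrite (eq_integral (fun x => (\1_A x)%:E)); first by rewrite integral_indic// setIT.
  by move=> t _ /=; rewrite ger0_norm.
by apply/funext => x; rewrite indicE; case: (x \in A); rewrite ?expr1n ?expr0n.
Qed.

Lemma L2_L1 A f : measurable A -> (mu A < +oo)%E -> (forall x, ~ A x -> f x = 0) ->
  L2 f -> L1 mu f.
Proof.
move=> mA Afin f0 i.
rewrite (_ : f = fun x => f x * \1_A x); first by apply: L2M => //; exact: L2_indic.
apply/funext => x; rewrite indicE; case: (asboolP (A x)) => Ax.
  by rewrite mem_set// mulr1.
by rewrite memNset// mulr0 f0.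
Qed.

(** The integral of (r f - g)^2 is nonnegative for all r; the bound is this fact at its minimizer r
    = c / a. *)
Lemma cauchy_schwarz f g : L2 f -> L2 g ->
  (\int[mu]_x (f x * g x)) ^+ 2 <= (\int[mu]_x (f x ^+ 2)) * (\int[mu]_x (g x ^+ 2)).
Proof.
move=> i j; have ij := L2M i j; have [mf f2] := i; have [mg g2] := j.
set a := \int[mu]_x (f x ^+ 2); set b := \int[mu]_x (g x ^+ 2).
set c := \int[mu]_x (f x * g x).
have H r : 0 <= r ^+ 2 * a - 2 * r * c + b.
  rewrite /a /b /c -!RintZ// -RintB -?RintD//; try exact: L1Z.
    apply: Rint_ge0 => x.
    rewrite (_ : _ - _ + _ = (r * f x - g x) ^+ 2) ?sqr_ge0//; ring.
  by apply: L1B; exact: L1Z.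
have a0 : 0 <= a by apply: Rint_ge0 => x; exact: sqr_ge0.
(* If a = 0 the quadratic degenerates to b - 2 r c, which for nonzero c would equal -1 at r = (b +
   1) / (2 c). *)
have [a_eq0|a_neq0] := eqVneq a 0.
  have [->|c0] := eqVneq c 0; first by rewrite a_eq0 mul0r expr0n.
  have := H ((b + 1) / (2 * c)); rewrite a_eq0 mulr0 add0r.
  rewrite (_ : 2 * _ * c = b + 1); first by lra.
  by field.
have := H (c / a).
rewrite (_ : _ - _ + b = (a * b - c ^+ 2) / a); last by field.
rewrite pmulr_lge0 ?subr_ge0// invr_gt0 lt_def a_neq0; exact: a0.
Qed.

End square_integrable.

(** * Products *)

Section product.
Context d1 d2 (T1 : measurableType d1) (T2 : measurableType d2) (R : realType).
Variable m1 : {sigma_finite_measure set T1 -> \bar R}.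
Variable m2 : {sigma_finite_measure set T2 -> \bar R}.
Local Notation m12 := (m1 \x m2)%E.
Implicit Types u : T1 * T2 -> R.

Lemma meas_section1 u x : meas u -> meas (fun y => u (x, y)).
Proof. by move=> mu; exact: measurableT_comp. Qed.

Lemma meas_section2 u y : meas u -> meas (fun x => u (x, y)).
Proof. by move=> mu; exact: measurableT_comp. Qed.

(** Integrability is not assumed: Tonelli makes the integrals of the positive and negative parts
    measurable, and [fine] sends infinite values to 0 measurably. *)
Lemma meas_Rint2 u : meas u -> meas (fun x => \int[m2]_y u (x, y)).
Proof.
move=> mu; apply: (measurableT_comp (f := fine)); first exact: fine_measurable.
have /measurable_EFinP me := mu.
rewrite (_ : (fun x => _) = ((fun x => \int[m2]_y (EFin \o u)^\+ (x, y)) \-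
   (fun x => \int[m2]_y (EFin \o u)^\- (x, y)))%E); last first.
  apply/funext => x; rewrite integralE; congr (_ - _)%E.
    by apply: eq_integral => y _; rewrite !funeposE.
  by apply: eq_integral => y _; rewrite !funenegE.
apply: emeasurable_funB; apply: measurable_fun_fubini_tonelli_F => //.
- exact: measurable_funepos.
- exact: measurable_funeneg.
Qed.

Lemma L1_section1 u : L1 m12 u -> {ae m1, forall x, L1 m2 (fun y => u (x, y))}.
Proof. exact: ae_integrable1. Qed.

Lemma L1_section2 u : L1 m12 u -> {ae m2, forall y, L1 m1 (fun x => u (x, y))}.
Proof. exact: ae_integrable2. Qed.

Lemma L1_Rint2 u : L1 m12 u -> L1 m1 (fun x => \int[m2]_y u (x, y)).
Proof.
move=> i; have := integrable_fubini_F i; apply: le_integrable => //.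
  by apply/measurable_EFinP; apply: meas_Rint2; exact: L1_meas i.
move=> x _ /=; rewrite /fubini_F/=.
by rewrite /Rintegral; case: (integral _ _ _) => [r| |] //=; rewrite normr0 leey.
Qed.

Lemma Fubini_Rint1 u : L1 m12 u ->
  \int[m12]_z u z = \int[m1]_x \int[m2]_y u (x, y).
Proof.
move=> i; rewrite [LHS]/Rintegral -(integral12_prod_meas1 i)/=; congr fine.
apply: ae_eq_integral => //.
- exact: measurable_int (integrable_fubini_F i).
- by apply/measurable_EFinP; apply: meas_Rint2; exact: L1_meas i.
- by apply: filterS (L1_section1 i) => x ix _; rewrite /fubini_F (L1_EFin ix).
Qed.

Lemma L1_tonelli1 u : meas u -> {ae m1, forall x, L1 m2 (fun y => u (x, y))} ->
  L1 m1 (fun x => \int[m2]_y `|u (x, y)|) -> L1 m12 u.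
Proof.
move=> mu ae /integrableP[_ i].
apply/integrable12ltyP; first exact/measurable_EFinP.
apply: le_lt_trans i; apply: ae_ge0_le_integral => //.
- by move=> x _; exact: integral_ge0.
- apply: (measurable_fun_fubini_tonelli_F (abse \o (EFin \o u))) => //.
    by apply: measurableT_comp => //; exact/measurable_EFinP.
  by move=> x /=.
- apply: measurableT_comp => //; apply/measurable_EFinP.
  apply: (@meas_Rint2 (fun z => `|u z|)); exact: measurableT_comp.
- apply: filterS ae => x ix _.
  have /L1_EFin /= -> := L1_norm ix.
  by rewrite lee_fin ler_norm.
Qed.

End product.

Section swap.
Context d1 d2 (T1 : measurableType d1) (T2 : measurableType d2) (R : realType).
Variable m1 : {sigma_finite_measure set T1 -> \bar R}.
Variable m2 : {sigma_finite_measure set T2 -> \bar R}.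
Implicit Types u : T1 * T2 -> R.

Lemma meas_swap u : meas u -> meas (fun z : T2 * T1 => u (z.2, z.1)).
Proof. by move=> mu; apply: (measurableT_comp mu); exact: measurable_swap. Qed.

(** For both product measures, integrability can be tested on one and the same iterated integral of
    |u|. *)
Lemma L1_swap u : L1 (m1 \x m2)%E u -> L1 (m2 \x m1)%E (fun z => u (z.2, z.1)).
Proof.
move=> i; have m := L1_meas i.
apply/integrable12ltyP => /=.
  by apply/measurable_EFinP; exact: meas_swap.
by apply: ((integrable21ltyP _ _ _).1 i); exact/measurable_EFinP.
Qed.

Lemma Fubini_Rint2 u : L1 (m1 \x m2)%E u ->
  \int[(m1 \x m2)%E]_z u z = \int[m2]_y \int[m1]_x u (x, y).
Proof.
move=> i; have j := L1_swap i; rewrite -(Fubini_Rint1 j).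
congr fine; rewrite -(integral12_prod_meas1 j) -(integral21_prod_meas1 i).
by [].
Qed.

Lemma Rint_swap u : L1 (m1 \x m2)%E u ->
  \int[(m2 \x m1)%E]_z u (z.2, z.1) = \int[(m1 \x m2)%E]_z u z.
Proof. by move=> i; rewrite (Fubini_Rint1 (L1_swap i)) (Fubini_Rint2 i). Qed.

Lemma L1_Rint1 u : L1 (m1 \x m2)%E u -> L1 m2 (fun y => \int[m1]_x u (x, y)).
Proof. by move=> /L1_swap/L1_Rint2. Qed.

Lemma L2_swap u : L2 (m1 \x m2)%E u -> L2 (m2 \x m1)%E (fun z => u (z.2, z.1)).
Proof. by move=> [mu i]; split; [exact: meas_swap|exact: L1_swap i]. Qed.

Lemma L2_section1 u : L2 (m1 \x m2)%E u ->
  {ae m1, forall x, L2 m2 (fun y => u (x, y))}.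
Proof.
move=> [mu /L1_section1]; apply: filterS => x i; split => //.
exact: meas_section1.
Qed.

Lemma L2_section2 u : L2 (m1 \x m2)%E u ->
  {ae m2, forall y, L2 m1 (fun x => u (x, y))}.
Proof.
move=> [mu /L1_section2]; apply: filterS => x i; split => //.
exact: meas_section2.
Qed.

Lemma L1_tensor (f : T1 -> R) (g : T2 -> R) : L1 m1 f -> L1 m2 g ->
  L1 (m1 \x m2)%E (fun z => f z.1 * g z.2).
Proof.
move=> i j.
apply: L1_tonelli1.
- apply: measurable_funM.
    by apply: (measurableT_comp (L1_meas i)); exact: measurable_fst.
  by apply: (measurableT_comp (L1_meas j)); exact: measurable_snd.
- by apply: aeW => x /=; exact: L1Z.
- under eq_fun do under eq_fun do rewrite normrM/=.
  rewrite (_ : (fun x => _) = (fun x => (\int[m2]_y `|g y|) * `|f x|)).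
    by apply: L1Z; exact: L1_norm.
  apply/funext => x; rewrite RintZ; [exact: mulrC|exact: L1_norm].
Qed.

End swap.

(** * Integral operators in one variable *)

Section volterra.
Context {R : realType}.
Local Notation leb := (@lebesgue_measure R).
Local Notation leb2 := ((@lebesgue_measure R) \x (@lebesgue_measure R))%E.
Implicit Types (f g : R -> R) (u v k : R * R -> R).

(** An integral operator in the first variable. With k = 1_{s<t} it is the primitive from the left
    end, with the transposed kernel the integral up to the right end; primitives in space are
    obtained by exchanging the variables of [u]. *)
Definition volt k u : R * R -> R := fun z => \int[leb]_s (k (z.1, s) * u (s, z.2)).
Definition transp k : R * R -> R := fun z => k (z.2, z.1).
Definition bker k := meas k /\ forall z, `|k z| <= 1.

Lemma bker_transp k : bker k -> bker (transp k).
Proof. by move=> [mk k1]; split => [|z]; [exact: meas_swap|exact: k1]. Qed.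

Lemma bker_lt : bker (fun z : R * R => (z.2 < z.1)%R%:R).
Proof.
split=> [|z]; last by case: (_ < _) => /=; rewrite ?normr1 ?normr0.
rewrite (_ : (fun z => _) = (fun z : R * R => if z.2 < z.1 then 1 else 0 : R)).
  by apply: measurable_fun_ifT => //; apply: measurable_fun_ltr.
by apply/funext => z; case: ifP.
Qed.

Lemma meas_volt k u : meas k -> meas u -> meas (volt k u).
Proof.
move=> mk mu.
apply: (@meas_Rint2 _ _ _ _ _ leb (fun zz : (R * R) * R =>
  k (zz.1.1, zz.2) * u (zz.2, zz.1.2))).
have m11 : meas (fun zz : (R * R) * R => zz.1.1).
  by apply: (measurableT_comp (f := fst)).
have m12 : meas (fun zz : (R * R) * R => zz.1.2).
  by apply: (measurableT_comp (f := snd)).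
apply: measurable_funM.
  by apply: (measurableT_comp mk); exact: measurable_fun_pair.
by apply: (measurableT_comp mu); exact: measurable_fun_pair.
Qed.

Lemma L1_bker k f t : bker k -> L1 leb f -> L1 leb (fun s => k (t, s) * f s).
Proof.
move=> [mk k1] i; apply: (@L1_dom _ _ _ leb _ (fun s => `|f s|)).
- by apply: measurable_funM; [exact: meas_section1|exact: L1_meas i].
- by move=> s; rewrite normrM ler_piMl.
- exact: L1_norm.
Qed.

Lemma volt_adjoint1 k f g : bker k -> L1 leb f -> L1 leb g ->
  \int[leb]_t (g t * \int[leb]_s (k (t, s) * f s)) =
  \int[leb]_s (f s * \int[leb]_t (k (t, s) * g t)).
Proof.
move=> bk i j; have [mk k1] := bk.
pose W z := k z * (g z.1 * f z.2).
have iW : L1 leb2 W.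
  apply: (@L1_dom _ _ _ leb2 _ (fun z => `|g z.1 * f z.2|)).
  - by apply: measurable_funM => //; exact: L1_meas (L1_tensor j i).
  - by move=> z; rewrite /W normrM ler_piMl.
  - by apply: L1_norm; exact: L1_tensor.
transitivity (\int[leb2]_z W z).
  rewrite (Fubini_Rint1 iW); apply: Rint_eq => t.
  rewrite -RintZ; last exact: L1_bker.
  by apply: Rint_eq => s; rewrite /W/=; ring.
rewrite (Fubini_Rint2 iW); apply: Rint_eq => s.
rewrite -RintZ; last exact: (L1_bker s (bker_transp bk)).
by apply: Rint_eq => t; rewrite /W/=; ring.
Qed.

Variable A : set R.
Hypothesis mA : measurable A.
Hypothesis finA : (leb A < +oo)%E.
Let a := \int[leb]_s (\1_A s : R).

Definition supp1 u := forall z, ~ A z.1 -> u z = 0.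

Lemma supp1_section u y s : supp1 u -> ~ A s -> u (s, y) = 0.
Proof. by move=> su As; apply: su. Qed.

(** Cauchy-Schwarz against 1_A: as [f] vanishes off [A], the kernel may be multiplied by 1_A, and
    the square of that product has integral at most [a], the measure of [A]. *)
Lemma bker_sq_le k f t : bker k -> (forall s, ~ A s -> f s = 0) -> L2 leb f ->
  (\int[leb]_s (k (t, s) * f s)) ^+ 2 <= a * \int[leb]_s (f s ^+ 2).
Proof.
move=> bk f0 i; have [mk k1] := bk.
have iA := @L2_indic _ _ _ leb _ mA finA.
have j : L2 leb (fun s => k (t, s) * \1_A s).
  apply: (@L2_dom _ _ _ leb 1 _ \1_A) => //.
    by apply: measurable_funM; [exact: meas_section1|exact: measurable_indic].
  by move=> s; rewrite normrM ler_wpM2r.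
have sqA s : \1_A s ^+ 2 = \1_A s :> R.
  by rewrite indicE; case: (s \in A); rewrite ?expr1n ?expr0n.
have := cauchy_schwarz j i.
rewrite (_ : \int[leb]_x _ = \int[leb]_s (k (t, s) * f s)); last first.
  apply: Rint_eq => s; rewrite indicE; case: (asboolP (A s)) => As.
    by rewrite mem_set// mulr1.
  by rewrite f0// !mulr0.
move=> /le_trans; apply; apply: ler_wpM2r.
  by apply: Rint_ge0 => s; exact: sqr_ge0.
apply: Rint_le.
- by case: j.
- by case: iA => _; under eq_fun do rewrite sqA.
- move=> s; rewrite exprMn sqA ler_piMl//.
  rewrite -(real_normK (num_real _)) expr_le1//.
Qed.

(** The bound holds at every [t], not only almost every one, because the exceptional set of [x]
    depends on [u] alone. This uniformity provides the a priori bound that Gronwall's lemma needs,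
    and gives a meaning to eta(0). *)
Lemma volt_row k u t : bker k -> supp1 u -> L2 leb2 u ->
  L2 leb (fun x => volt k u (t, x)) /\
  \int[leb]_x (volt k u (t, x) ^+ 2) <= a * \int[leb2]_z (u z ^+ 2).
Proof.
move=> bk su i; have [mu i2] := i.
have mv : meas (fun x => volt k u (t, x)).
  by apply: meas_section1; apply: meas_volt => //; case: bk.
have j := L1Z a (L1_Rint1 i2).
have le : {ae leb, forall x, volt k u (t, x) ^+ 2 <= a * \int[leb]_s (u (s, x) ^+ 2)}.
  apply: (ae_imp (mu := leb) (L2_section2 i)) => x ix.
  by apply: (bker_sq_le t bk _ ix) => s; exact: supp1_section.
have i3 : L1 leb (fun x => volt k u (t, x) ^+ 2).
  apply: L1_dom_ae j; first exact: measurable_funX.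
  by apply: (ae_imp (mu := leb) le) => x; rewrite ger0_norm// sqr_ge0.
split => //; rewrite (Fubini_Rint2 i2) -RintZ; last exact: L1_Rint1 i2.
exact: Rint_ae_le.
Qed.

(** The factor 1_A is essential: a primitive stays constant after the support of [u] ends, so it is
    in general not square integrable on the plane. *)
Lemma L2_volt k u : bker k -> supp1 u -> L2 leb2 u ->
  L2 leb2 (fun z => \1_A z.1 * volt k u z).
Proof.
move=> bk su i; have [mu i2] := i.
have m : meas (fun z => \1_A z.1 * volt k u z).
  apply: measurable_funM; last by apply: meas_volt => //; case: bk.
  have mI : meas (\1_A : R -> R) by exact: measurable_indic.
  by apply: (measurableT_comp mI); exact: measurable_fst.
split => //; apply: L1_tonelli1; first exact: measurable_funX.
  apply: aeW => t /=; under eq_fun do rewrite exprMn.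
  by apply: L1Z; case: (volt_row t bk su i) => -[].
apply: (@L1_dom _ _ _ leb _ (fun t => (a * \int[leb2]_z (u z ^+ 2)) * \1_A t ^+ 2)).
- apply: (@meas_Rint2 _ _ _ _ _ leb (fun z => `|(\1_A z.1 * volt k u z) ^+ 2|)).
  by apply: measurableT_comp => //; exact: measurable_funX.
- move=> t; rewrite ger0_norm; last exact: Rint_ge0.
  have [[mv iv] le] := volt_row t bk su i.
  rewrite (_ : \int[leb]_y _ = \1_A t ^+ 2 * \int[leb]_x (volt k u (t, x) ^+ 2)).
    by rewrite mulrC ler_wpM2r// sqr_ge0.
  rewrite -RintZ//; apply: Rint_eq => x /=.
  by rewrite ger0_norm ?sqr_ge0// exprMn.
- by apply: L1Z; case: (@L2_indic _ _ _ leb _ mA finA).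
Qed.

Lemma supp1_indic v z : supp1 v -> v z * \1_A z.1 = v z.
Proof.
move=> sv; rewrite indicE; case: (asboolP (A z.1)) => Az.
  by rewrite mem_set// mulr1.
by rewrite sv// mul0r.
Qed.

Lemma L1_mul_volt k u v : bker k -> supp1 u -> supp1 v -> L2 leb2 u ->
  L2 leb2 v -> L1 leb2 (fun z => v z * volt k u z).
Proof.
move=> bk su sv i j; have := L2M j (L2_volt bk su i).
rewrite (_ : (fun z => _) = (fun z => v z * volt k u z))//.
by apply/funext => z; rewrite mulrA supp1_indic.
Qed.

Lemma volt_adjoint k u v : bker k -> supp1 u -> supp1 v -> L2 leb2 u ->
  L2 leb2 v ->
  \int[leb2]_z (v z * volt k u z) = \int[leb2]_z (u z * volt (transp k) v z).
Proof.
move=> bk su sv i j.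
have bkt := bker_transp bk.
have w := L1_mul_volt bk su sv i j.
have w' := L1_mul_volt bkt sv su j i.
rewrite (Fubini_Rint2 w) (Fubini_Rint2 w').
apply: Rint_ae_eq; [exact: L1_meas (L1_Rint1 w)|exact: L1_meas (L1_Rint1 w')|].
apply: (ae_imp2 (mu := leb) (L2_section2 i) (L2_section2 j)) => x ix jx.
apply: (@volt_adjoint1 k (fun s => u (s, x)) (fun t => v (t, x)) bk).
  by apply: (@L2_L1 _ _ _ leb A) ix => // s; exact: supp1_section.
by apply: (@L2_L1 _ _ _ leb A) jx => // s; exact: supp1_section.
Qed.

End volterra.

(** * The square of a primitive, without differentiation *)

Section square_of_primitive.
Context {R : realType}.
Local Notation leb := (@lebesgue_measure R).

(** The square of the integral is a double integral of f(s) f(r); the triangles r < s and s < r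
    contribute equally by the adjoint identity. *)
Lemma Rint_sqr (f : R -> R) : L1 leb f ->
  (\int[leb]_s f s) ^+ 2 = 2 * \int[leb]_s (f s * \int[leb]_r ((r < s)%R%:R * f r)).
Proof.
move=> i; have bk := @bker_lt R; have bkt := bker_transp bk.
have iF (k : R * R -> R) : bker k -> L1 leb (fun s => f s * \int[leb]_r (k (s, r) * f r)).
  move=> bk'; apply: (@L1_dom _ _ _ leb _ (fun s => (\int[leb]_r `|f r|) * `|f s|)).
  - apply: measurable_funM; first exact: L1_meas i.
    apply: (@meas_Rint2 _ _ _ _ _ leb (fun z => k z * f z.2)).
    apply: measurable_funM; first by case: bk'.
    by apply: (measurableT_comp (L1_meas i)); exact: measurable_snd.
  - move=> s; rewrite normrM mulrC ler_wpM2r//.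
    have j := L1_bker s bk' i.
    apply: (le_trans (le_normr_Rintegral measurableT j)).
    apply: Rint_le; [exact: L1_norm|exact: L1_norm|move=> r].
    by rewrite normrM ler_piMl//; apply: bk'.2.
  - by apply: L1Z; exact: L1_norm.
rewrite mulr_natl mulr2n [X in _ = _ + X](volt_adjoint1 bk i i).
rewrite -RintD; [|exact: (iF _ bk)|exact: (iF _ bkt)].
rewrite expr2 -RintZ//; apply: Rint_eq => s.
rewrite -mulrDr mulrC; congr (_ * _).
rewrite -RintD; [|exact: (L1_bker s bk i)|exact: (L1_bker s bkt i)].
apply: Rint_ae_eq; first exact: L1_meas i.
  apply: measurable_funD; first exact: L1_meas (L1_bker s bk i).
  exact: L1_meas (L1_bker s bkt i).
(* The two kernels add up to 1 except on the diagonal r = s, a null set for each fixed [s]. *)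
exists [set s]; split => //; first exact: lebesgue_measure_set1.
move=> r /=; apply: contra_notP => /eqP rs /=.
rewrite /transp/= -mulrDl.
by have [| |/eqP] := ltgtP r s; rewrite ?addr0 ?add0r ?mul1r// (negbTE rs).
Qed.

(** [Rint_sqr] for [f] cut off at [t]; the inner cut-off r < t is implied by r < s < t. It replaces
    the formula (Phi^2)' = 2 Phi Phi'. *)
Lemma primitive_sqr (f : R -> R) t : L1 leb f ->
  (\int[leb]_s ((s < t)%R%:R * f s)) ^+ 2 =
  2 * \int[leb]_s ((s < t)%R%:R * (f s * \int[leb]_r ((r < s)%R%:R * f r))).
Proof.
move=> i; rewrite Rint_sqr; last exact: (L1_bker t (@bker_lt R) i).
congr (_ * _); apply: Rint_eq => s; rewrite mulrA.
have [st|] := ltP s t; last by rewrite !mul0r.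
congr (_ * _); apply: Rint_eq => r.
by have [rs|] := ltP r s; rewrite ?mul0r// (lt_trans rs st) mul1r.
Qed.

End square_of_primitive.

(** * Gronwall's lemma *)

Section gronwall.
Context {R : realType}.
Local Notation leb := (@lebesgue_measure R).

(** [m] is only integrable and [y] only measurable and bounded, so the argument rests on absolute
    continuity of the integral of [m]: on intervals shorter than [D] it is below 1 / (2 C), and the
    zero set of [Y] can be prolonged by a fixed length. *)
Lemma gronwall (m y : R -> R) (B C : R) : L1 leb m -> (forall s, 0 <= m s) ->
  (forall s, s <= 0 -> m s = 0) -> meas y -> (forall t, 0 <= y t <= B) -> 0 < C ->
  (forall t, y t <= C * \int[leb]_s ((s < t)%R%:R * (m s * y s))) ->
  forall t, \int[leb]_s ((s < t)%R%:R * (m s * y s)) = 0.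
Proof.
move=> im m0 mneg my yB C0 Hy.
pose Y t := \int[leb]_s ((s < t)%R%:R * (m s * y s)).
have y0 t : 0 <= y t by have /andP[] := yB t.
have imy : L1 leb (fun s => m s * y s).
  apply: (@L1_dom _ _ _ leb _ (fun s => B * m s)); last exact: L1Z.
    by apply: measurable_funM => //; exact: L1_meas im.
  move=> s; rewrite ger0_norm ?mulr_ge0// mulrC ler_wpM2r//.
  by have /andP[] := yB s.
have bk := @bker_lt R.
have iY t : L1 leb (fun s => (s < t)%R%:R * (m s * y s)) by exact: (L1_bker t bk imy).
have my0 s : 0 <= m s * y s by exact: mulr_ge0.
have Y0 t : 0 <= Y t by apply: Rint_ge0 => s; rewrite mulr_ge0.
have Ymono t t' : t <= t' -> Y t <= Y t'.
  move=> tt'; apply: Rint_le => // s; apply: ler_wpM2r => //.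
  by have [st|] := ltP s t; rewrite ?(lt_le_trans st tt')//.
have [D [D0 HD]] : exists D : R, (0 < D) /\ forall A, measurable A ->
    (leb A < D%:E)%E -> \int[leb]_(x in A) `|m x| < (2 * C)^-1.
  apply: (@integral_normr_continuous _ _ _ leb _ im).
  by rewrite invr_gt0 mulr_gt0.
apply: contrapT => /existsNP[t2 /eqP Yt2].
(* Since [Y] is nonnegative and nondecreasing, a point where it is nonzero bounds [E] from above. *)
pose E := [set t | Y t = 0].
have E0 : E 0.
  apply: Rint_eq0 => s.
  by have [s0|] := ltP s 0; rewrite ?mul0r// mneg ?(ltW s0)// mul0r mulr0.
have Eub : ubound E t2.
  move=> t Et; rewrite leNgt; apply/negP => t2t; move/eqP: Yt2; apply.
  by apply/eqP; rewrite eq_le Y0 andbT -Et Ymono// ltW.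
have hsE : has_sup E by split; [exists 0|exists t2].
(* [t0] is a zero of [Y] just below sup E and [t1] lies just above it, less than D / 2 apart;
   proving that [t1] is in [E] contradicts the supremum. *)
have [t0 Et0 t0lt] := @sup_adherent R E (D / 4) (ltac:(lra)) hsE.
pose t1 := sup E + D / 4.
suff Et1 : E t1.
  by have := sup_upper_bound hsE Et1; rewrite /t1; lra.
have t01 : t0 <= t1.
  by apply: (le_trans (sup_upper_bound hsE Et0)); rewrite /t1; lra.
have t10 : t1 - t0 < D by rewrite /t1; lra.
have split_Y : Y t1 = \int[leb]_s (((s < t1)%R%:R - (s < t0)%R%:R) * (m s * y s)).
  rewrite -[LHS]subr0 -[X in _ - X]Et0 -RintB//; apply: Rint_eq => s.
  by rewrite mulrBl.
have chi s : (s < t1)%R%:R - (s < t0)%R%:R = \1_`[t0, t1[ s :> R.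
  rewrite indicE mem_setE in_itv/=.
  have [st0|st0] := ltP s t0; last by rewrite subr0.
  by rewrite (lt_le_trans st0 t01) subrr.
have small : \int[leb]_s (\1_`[t0, t1[ s * m s) <= (2 * C)^-1.
  have := HD `[t0, t1[%classic.
  rewrite lebesgue_measure_itv/= lte_fin.
  have -> : \int[leb]_(x in `[t0, t1[) `|m x| = \int[leb]_s (\1_`[t0, t1[ s * m s).
    rewrite Rintegral_mkcond; apply: Rint_eq => s; rewrite patchE indicE.
    by case: ifPn => _; rewrite ?mul0r// mul1r ger0_norm.
  move=> /(_ _ _)/ltW; apply.
    exact: measurable_itv.
  by case: ifPn => _; rewrite -?EFinB lte_fin.
have i1 : L1 leb (fun s => \1_`[t0, t1[ s * m s).
  apply: (@L1_dom _ _ _ leb _ m) => //.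
    by apply: measurable_funM; [exact: measurable_indic|exact: L1_meas im].
  move=> s; rewrite normrM indicE; case: (_ \in _).
    by rewrite normr1 mul1r ger0_norm.
  by rewrite normr0 mul0r.
(* As [Y] vanishes at [t0], only [t0, t1[ contributes, and there y s <= C * Y s <= C * Y t1 by
   monotonicity. *)
have le : Y t1 <= C * Y t1 * (2 * C)^-1.
  rewrite {1}split_Y.
  apply: (@le_trans _ _ (\int[leb]_s (C * Y t1 * (\1_`[t0, t1[ s * m s)))).
    apply: Rint_le.
    - by under eq_fun do rewrite mulrBl; exact: L1B.
    - exact: L1Z.
    - move=> s; rewrite chi indicE mem_setE in_itv/=.
      case: (boolP (t0 <= s < t1)) => [/andP[_ st1]|_]; last first.
        by rewrite !mul0r mulr0.
      rewrite !mul1r mulrC ler_wpM2r//.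
      apply: (le_trans (Hy s)); rewrite ler_wpM2l ?(ltW C0)//.
      by apply: Ymono; exact: ltW.
  rewrite RintZ//.
  by rewrite ler_wpM2l// mulr_ge0// ltW.
rewrite /E/=; apply/eqP; rewrite eq_le Y0 andbT.
have -> : Y t1 = 2 * (C * Y t1 * (2 * C)^-1).
  by field; rewrite gt_eqF.
move: le; rewrite (_ : C * Y t1 * (2 * C)^-1 = Y t1 / 2); first lra.
by field; rewrite gt_eqF.
Qed.

End gronwall.

(** * The estimate at a fixed time *)

(** Young's inequality with exponents 4/3 and 4, in fourth powers so that no fractional power
    occurs. With p = e a and q = K / (4 e^3) z, the right-hand side of the hypothesis is 4 p^3 q, a
    single term of the expansion of (p + q)^4. *)
Lemma young4 (R : realType) (K e a z X : R) : 0 < e -> 0 <= K -> 0 <= a -> 0 <= z ->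
  X ^+ 4 <= K * (a ^+ 3 * z) -> X <= e * a + K / (4 * e ^+ 3) * z.
Proof.
move=> e0 K0 a0 z0 HX; rewrite leNgt; apply/negP => lt.
set c := K / (4 * e ^+ 3) in lt.
have c0 : 0 <= c by rewrite divr_ge0// mulr_ge0// exprn_ge0// ltW.
have KE : K = 4 * e ^+ 3 * c by rewrite /c; field; rewrite gt_eqF.
have ea0 : 0 <= e * a by rewrite mulr_ge0// ltW.
have cz0 : 0 <= c * z by rewrite mulr_ge0.
have : (e * a + c * z) ^+ 4 < X ^+ 4.
  by rewrite ltr_pXn2r// nnegrE ?addr_ge0// ltW// (le_lt_trans _ lt)// addr_ge0.
rewrite ltNge => /negP; apply; apply: (le_trans HX); rewrite KE.
set p := e * a in ea0 *; set q := c * z in cz0 *.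
rewrite (_ : 4 * e ^+ 3 * c * (a ^+ 3 * z) = 4 * (p ^+ 3 * q)); last by rewrite /p /q; ring.
rewrite (_ : (p + q) ^+ 4 = 4 * (p ^+ 3 * q) +
  (p ^+ 4 + 6 * (p ^+ 2 * q ^+ 2) + 4 * (p * q ^+ 3) + q ^+ 4)); last by ring.
by rewrite lerDl; repeat apply: addr_ge0; repeat apply: mulr_ge0 => //; apply: exprn_ge0.
Qed.

Section slice.
Context {R : realType}.
Local Notation leb := (@lebesgue_measure R).
Variable B : set R.
Hypothesis mB : measurable B.
Hypothesis finB : (leb B < +oo)%E.

(** The square of the primitive Phi of [U] is twice the integral of U Phi over y < x. There Phi may
    be replaced by [G], as [U] vanishes off [B], and Cauchy-Schwarz concludes. The fourth power
    keeps square roots out of the statement. *)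
Lemma primitive_sup (U G : R -> R) : L2 leb U -> L2 leb G ->
  (forall x, ~ B x -> U x = 0) ->
  {ae leb, forall x, B x -> G x = \int[leb]_y ((y < x)%R%:R * U y)} ->
  forall x, (\int[leb]_y ((y < x)%R%:R * U y)) ^+ 4 <=
    4 * ((\int[leb]_y (U y ^+ 2)) * \int[leb]_y (G y ^+ 2)).
Proof.
move=> iU iG U0 GE x; have [mU _] := iU; have [mG _] := iG.
have U1 := @L2_L1 _ _ _ leb B U mB finB U0 iU.
have bk := @bker_lt R.
pose Phi x := \int[leb]_y ((y < x)%R%:R * U y).
have mPhi : meas Phi.
  apply: (@meas_Rint2 _ _ _ _ _ leb (fun z : R * R => (z.2 < z.1)%R%:R * U z.2)).
  apply: measurable_funM; first by case: bk.
  by apply: (measurableT_comp mU); exact: measurable_snd.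
have ml : meas (fun y : R => (y < x)%R%:R : R) by exact: (meas_section1 x bk.1).
have -> : (\int[leb]_y ((y < x)%R%:R * U y)) ^+ 4 =
    4 * (\int[leb]_y (U y * ((y < x)%R%:R * G y))) ^+ 2.
  rewrite -[4%N]/(2 * 2)%N exprM (primitive_sqr x U1) exprMn -natrX; congr (_ * _ ^+ 2).
  apply: Rint_ae_eq.
  - by apply: measurable_funM => //; exact: measurable_funM.
  - by apply: measurable_funM => //; exact: measurable_funM.
  - apply: (ae_imp (mu := leb) GE) => y GyE.
    have [By|nBy] := asboolP (B y); last by rewrite U0// !mul0r mulr0.
    by rewrite GyE//; ring.
rewrite ler_wpM2l//.
have lG : L2 leb (fun y => (y < x)%R%:R * G y).
  apply: (@L2_dom _ _ _ leb 1 _ G) => //; first exact: measurable_funM.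
  by move=> y; rewrite normrM ler_wpM2r//; exact: (bk.2 (x, y)).
apply: (le_trans (cauchy_schwarz iU lG)); apply: ler_wpM2l.
  by apply: Rint_ge0 => y; exact: sqr_ge0.
apply: Rint_le; [by case: lG|by case: iG|move=> y].
by rewrite exprMn; case: (y < x) => /=; rewrite ?expr1n ?mul1r// expr0n mul0r sqr_ge0.
Qed.

(** With X the integral of |w| |p|, the left side is at most Cb |G|_oo X. Its fourth power is
    bounded by Cb^4 * 4 (Ch^2 a y) * (a q)^2 = (4 Cb^4 Ch^2) a^3 (q^2 y), the form that [young4]
    takes. *)
Lemma slice_estimate (Ch Cb e : R) (U w D p G : R -> R) :
  0 < e -> 0 <= Ch -> 0 <= Cb ->
  L2 leb U -> L2 leb w -> L2 leb p -> L2 leb G -> meas D ->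
  (forall x, ~ B x -> w x = 0) ->
  (forall x, `|U x| <= Ch * `|w x|) -> (forall x, `|D x| <= Cb * `|w x|) ->
  {ae leb, forall x, B x -> G x = \int[leb]_y ((y < x)%R%:R * U y)} ->
  \int[leb]_x (D x * p x * G x) <= e * (\int[leb]_x (w x ^+ 2)) +
    (4 * Cb ^+ 4 * Ch ^+ 2) / (4 * e ^+ 3) *
     ((\int[leb]_x (p x ^+ 2)) ^+ 2 * \int[leb]_x (G x ^+ 2)).
Proof.
move=> e0 Ch0 Cb0 iU iw ip iG mD w0 Uw Dw GE.
have [mU U2] := iU; have [mw w2] := iw; have [mp p2] := ip; have [mG G2] := iG.
have U0 x : ~ B x -> U x = 0.
  by move=> Bx; have := Uw x; rewrite w0// normr0 mulr0 normr_le0 => /eqP.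
set a := \int[leb]_x (w x ^+ 2); set q := \int[leb]_x (p x ^+ 2).
set y := \int[leb]_x (G x ^+ 2).
have a0 : 0 <= a by apply: Rint_ge0 => x; exact: sqr_ge0.
have q0 : 0 <= q by apply: Rint_ge0 => x; exact: sqr_ge0.
have y0 : 0 <= y by apply: Rint_ge0 => x; exact: sqr_ge0.
set uu := \int[leb]_x (U x ^+ 2).
have uu0 : 0 <= uu by apply: Rint_ge0 => x; exact: sqr_ge0.
have uua : uu <= Ch ^+ 2 * a.
  rewrite -RintZ//; apply: Rint_le => //; first exact: L1Z.
  move=> x; rewrite -[U x ^+ 2]real_normK ?num_real//.
  rewrite -[w x ^+ 2]real_normK ?num_real// -exprMn.
  by rewrite ler_pXn2r// nnegrE mulr_ge0.
(* The fourth root of the bound in [primitive_sup], hence an almost everywhere bound of |G| on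
   [B]. *)
pose bt := Num.sqrt (Num.sqrt (4 * (uu * y))).
have bt0 : 0 <= bt by exact: sqrtr_ge0.
have bt4 : bt ^+ 4 = 4 * (uu * y).
  rewrite -[4%N in LHS]/(2 * 2)%N exprM !sqr_sqrtr ?sqrtr_ge0//.
  by rewrite !mulr_ge0.
have Gb : {ae leb, forall x, B x -> `|G x| <= bt}.
  apply: (ae_imp (mu := leb) GE) => x Gx Bx; rewrite Gx//.
  rewrite -(@ler_pXn2r _ 4)// ?nnegrE// bt4 -normrX ger0_norm.
    exact: primitive_sup.
  by rewrite -[4%N]/(2 * 2)%N exprM sqr_ge0.
have iwp : L1 leb (fun x => `|w x| * `|p x|).
  apply: L2M.
    apply: (@L2_dom _ _ _ leb 1 _ w) => //; last by move=> x; rewrite normr_id mul1r.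
    exact: measurableT_comp.
  apply: (@L2_dom _ _ _ leb 1 _ p) => //; last by move=> x; rewrite normr_id mul1r.
  exact: measurableT_comp.
set X := \int[leb]_x (`|w x| * `|p x|).
have X0 : 0 <= X by apply: Rint_ge0 => x; rewrite mulr_ge0.
have XX : X ^+ 2 <= a * q.
  have nE f : (fun x : R => `|f x| ^+ 2) = (fun x : R => f x ^+ 2 : R).
    by apply/funext => x; rewrite real_normK ?num_real.
  have := @cauchy_schwarz _ _ _ leb (fun x => `|w x|) (fun x => `|p x|).
  rewrite !nE; apply.
    by split; [exact: measurableT_comp|rewrite nE].
  by split; [exact: measurableT_comp|rewrite nE].
have ae_le : {ae leb, forall x, `|D x * p x * G x| <= Cb * bt * (`|w x| * `|p x|)}.
  apply: (ae_imp (mu := leb) Gb) => x Gx.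
  have [Bx|nBx] := asboolP (B x); last first.
    have : `|D x| <= 0 by rewrite (le_trans (Dw x))// w0// normr0 mulr0.
    by rewrite normr_le0 => /eqP ->; rewrite !mul0r normr0 !mulr_ge0.
  rewrite !normrM (_ : Cb * bt * _ = Cb * `|w x| * `|p x| * bt); last by ring.
  apply: ler_pM => //; last exact: Gx.
  by apply: ler_pM.
have iDpG : L1 leb (fun x => D x * p x * G x).
  apply: L1_dom_ae ae_le _; last exact: L1Z.
  by apply: measurable_funM => //; exact: measurable_funM.
have le1 : \int[leb]_x (D x * p x * G x) <= Cb * bt * X.
  rewrite -RintZ//; apply: Rint_ae_le => //; first exact: L1Z.
  by apply: (ae_imp (mu := leb) ae_le) => x; apply: le_trans; exact: ler_norm.
apply: (le_trans le1); apply: young4 => //.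
- by rewrite !mulr_ge0// exprn_ge0.
- by rewrite mulr_ge0// exprn_ge0.
rewrite !exprMn bt4 (_ : X ^+ 4 = (X ^+ 2) ^+ 2); last by rewrite -exprM.
rewrite (_ : 4 * Cb ^+ 4 * Ch ^+ 2 * _ =
  Cb ^+ 4 * (4 * (Ch ^+ 2 * a * y)) * (a * q) ^+ 2); last by ring.
apply: ler_pM.
- by rewrite !mulr_ge0// exprn_ge0.
- by rewrite sqr_ge0.
- rewrite ler_wpM2l ?exprn_ge0// ler_wpM2l// ler_wpM2r//.
- by rewrite ler_pXn2r// nnegrE ?sqr_ge0// mulr_ge0.
Qed.

End slice.

(** * Test functions and weak derivatives *)

Section smooth_test_functions.
Context {R : realType}.
Local Notation leb := (@lebesgue_measure R).
Local Notation I01 := (@I01 R).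

Lemma derivable_continuous (f : R -> R) : (forall x, derivable f x 1) -> continuous f.
Proof.
by move=> df x; apply: differentiable_continuous; apply/derivable1_diffP/df.
Qed.

Lemma measurable_I01 : measurable I01.
Proof. exact: measurable_itv. Qed.

Lemma lebesgue_oo_lty (a b : R) : (leb `]a, b[%classic < +oo)%E.
Proof. by rewrite lebesgue_measure_itv/=; case: ifP => _; rewrite -?EFinB ltry. Qed.

Lemma lebesgue_I01_lty : (leb I01 < +oo)%E.
Proof. exact: lebesgue_oo_lty. Qed.

Lemma continuous_bounded01 (f : R -> R) : continuous f ->
  exists M, forall x, I01 x -> `|f x| <= M.
Proof.
move=> cf.
have c : {within `[0, 1], continuous (fun x => `|f x|)}.
  apply: continuous_subspaceT => x.
  by apply: continuous_comp; [exact: cf|exact: norm_continuous].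
have [x _ H] := EVT_max ler01 c.
exists `|f x| => y; rewrite /Defs.I01/= in_itv/= => /andP[y0 y1].
by apply: H; rewrite in_itv/= !ltW.
Qed.

Variable phi : R -> R.
Hypothesis Cphi : Cc_inf_01 phi.

Lemma Cc_continuous : continuous phi.
Proof. by apply: derivable_continuous => x; have := Cphi.1 0%N x. Qed.

Lemma Cc_derive_continuous : continuous (derive1 phi).
Proof. by apply: derivable_continuous => x; have := Cphi.1 1%N x. Qed.

Lemma Cc_meas : meas phi.
Proof. exact: continuous_measurable_fun Cc_continuous. Qed.

Lemma Cc_derive_meas : meas (derive1 phi).
Proof. exact: continuous_measurable_fun Cc_derive_continuous. Qed.

(** The lower limit contributes nothing since [phi] vanishes near 0. The kernel and the indicator
    are kept explicit to match the inner integral that [volt_adjoint1] produces. *)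
Lemma Cc_FTC y : I01 y ->
  \int[leb]_x ((x < y)%R%:R * (\1_I01 x * derive1 phi x)) = phi y.
Proof.
rewrite /Defs.I01/= in_itv/= => /andP[y0 y1].
have phi0 : phi 0 = 0.
  by have [_ [a [c [a0 [_ [_ H]]]]]] := Cphi; apply: H; left.
have cd := Cc_derive_continuous.
transitivity (\int[leb]_(x in `]0, y[) derive1 phi x).
  rewrite [RHS]Rintegral_mkcond; apply: Rint_eq => x.
  rewrite patchE indicE !mem_setE /= !in_itv/=.
  have [xy|_] := ltP x y; last by rewrite andbF; exact: mul0r.
  rewrite (lt_trans xy y1) !andbT mul1r.
  by case: (0 < x); [exact: mul1r|exact: mul0r].
have me D : measurable_fun D (derive1 phi) by exact: measurable_funTS Cc_derive_meas.
rewrite /Rintegral integral_itv_obnd_cbnd; last by apply/measurable_EFinP; exact: me.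
rewrite integral_itv_bndo_bndc; last by apply/measurable_EFinP; exact: me.
rewrite (@continuous_FTC2 _ _ phi)//=; first by rewrite phi0 subr0.
- exact: continuous_subspaceT.
- split.
  + by move=> x _; exact: (Cphi.1 0%N x).
  + by apply: cvg_at_right_filter; exact: Cc_continuous.
  + by apply: cvg_at_left_filter; exact: Cc_continuous.
Qed.

End smooth_test_functions.

(** * Functions supported in Q(T), and time integration of weak x-derivatives *)

Section cylinder.
Context {R : realType} (T : R).
Local Notation leb := (@lebesgue_measure R).
Local Notation leb2 := ((@lebesgue_measure R) \x (@lebesgue_measure R))%E.
Local Notation A := (I0T T).
Local Notation B := (@I01 R).
Implicit Types (u v : R * R -> R).

Definition ltk : R * R -> R := fun z => (z.2 < z.1)%R%:R.
Definition suppQ u := forall z, ~ QT T z -> u z = 0.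

Lemma bker_ltk : bker ltk. Proof. exact: bker_lt. Qed.

Lemma bker_gtk : bker (transp ltk). Proof. exact/bker_transp/bker_ltk. Qed.

Lemma measurable_I0T : measurable A. Proof. exact: measurable_itv. Qed.

Lemma lebesgue_I0T_lty : (leb A < +oo)%E. Proof. exact: lebesgue_oo_lty. Qed.

Local Notation mA := measurable_I0T.
Local Notation finA := lebesgue_I0T_lty.
Local Notation mB := (@measurable_I01 R).
Local Notation finB := (@lebesgue_I01_lty R).

Lemma suppQ1 u : suppQ u -> supp1 A u.
Proof. by move=> su z nA; apply: su => -[]. Qed.

Lemma suppQ_swap u : suppQ u -> supp1 B (fun z => u (z.2, z.1)).
Proof. by move=> su z nB; apply: su => -[]. Qed.

Lemma suppQ_sec1 u t x : suppQ u -> ~ B x -> u (t, x) = 0.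
Proof. by move=> su nB; apply: su => -[]. Qed.

Lemma suppQ_sec2 u t x : suppQ u -> ~ A t -> u (t, x) = 0.
Proof. by move=> su nB; apply: su => -[]. Qed.

Lemma volt_suppB k u t x : suppQ u -> ~ B x -> volt k u (t, x) = 0.
Proof.
move=> su nB; apply: Rint_eq0 => s /=.
by rewrite (suppQ_sec1 _ su nB) mulr0.
Qed.

Lemma suppQ_L1 u : suppQ u -> L2 leb2 u -> L1 leb2 u.
Proof.
move=> su iu; apply: (@L2_L1 _ _ _ leb2 (QT T)) => //.
  by apply: measurableX; [exact: mA|exact: mB].
rewrite [ltLHS]product_measure1E; [|exact: mA|exact: mB].
rewrite lte_mul_pinfty//; last exact: finB.
by rewrite ge0_fin_numE//; exact: finA.
Qed.

(** Fubini for k(t,s) u(s,x) psi(x) at a fixed but arbitrary [t]; the bound on [psi] is needed only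
    where [u] can be nonzero. *)
Lemma volt_pair k u t (psi : R -> R) M : bker k -> suppQ u -> L2 leb2 u ->
  meas psi -> (forall x, B x -> `|psi x| <= M) ->
  \int[leb]_x (volt k u (t, x) * psi x) =
  \int[leb]_s (k (t, s) * \int[leb]_x (u (s, x) * psi x)).
Proof.
move=> bk su iu mpsi psiM; have [mk k1] := bk; have [mu _] := iu.
have u1 := suppQ_L1 su iu.
have iup : L1 leb2 (fun z => u z * psi z.2).
  apply: (@L1_dom _ _ _ leb2 _ (fun z => M * `|u z|)).
  - apply: measurable_funM => //.
    by apply: (measurableT_comp mpsi); exact: measurable_snd.
  - move=> -[s x]/=; rewrite normrM mulrC.
    have [Bx|nBx] := asboolP (B x); first by rewrite ler_wpM2r// psiM.
    by rewrite (suppQ_sec1 _ su nBx) normr0 !mulr0.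
  - by apply: L1Z; exact: L1_norm.
pose W z := k (t, z.1) * (u z * psi z.2).
have mkt : meas (fun z : R * R => k (t, z.1)).
  by apply: (measurableT_comp (meas_section1 t mk)); exact: measurable_fst.
have iW : L1 leb2 W.
  apply: (@L1_dom _ _ _ leb2 _ (fun z => `|u z * psi z.2|)).
  - by apply: measurable_funM => //; exact: L1_meas iup.
  - by move=> z; rewrite /W normrM ler_piMl.
  - exact: L1_norm.
transitivity (\int[leb2]_z W z).
  rewrite (Fubini_Rint2 iW); apply: Rint_ae_eq.
  - apply: measurable_funM => //.
    by apply: (meas_section1 t); apply: meas_volt.
  - exact: L1_meas (L1_Rint1 iW).
  - apply: (ae_imp (mu := leb) (L1_section2 u1)) => x ux.
    rewrite /volt/= mulrC -RintZ; last exact: (L1_bker t bk ux).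
    by apply: Rint_eq => s; rewrite /W/=; ring.
rewrite (Fubini_Rint1 iW); apply: Rint_ae_eq.
- exact: L1_meas (L1_Rint2 iW).
- apply: measurable_funM; first exact: meas_section1.
  exact: L1_meas (L1_Rint2 iup).
- apply: (ae_imp (mu := leb) (L1_section1 iup)) => s us.
  by rewrite -RintZ.
Qed.

(* Meant for functions extended by zero outside Q(T), hence no restriction to I01. *)
Definition wdx u v := {ae leb, forall t, forall phi : R -> R, Cc_inf_01 phi ->
  \int[leb]_x (u (t, x) * derive1 phi x) = - \int[leb]_x (v (t, x) * phi x)}.

Lemma Cc_bounds (phi : R -> R) : Cc_inf_01 phi -> exists M, forall x, B x ->
  `|phi x| <= M /\ `|derive1 phi x| <= M.
Proof.
move=> Cphi.
have [M1 H1] := continuous_bounded01 (Cc_continuous Cphi).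
have [M2 H2] := continuous_bounded01 (Cc_derive_continuous Cphi).
exists (Num.max M1 M2) => x Bx; rewrite !le_max.
by rewrite H1// H2// orbT.
Qed.

Lemma L1_bounded (f psi : R -> R) M : L1 leb f -> (forall x, ~ B x -> f x = 0) ->
  meas psi -> (forall x, B x -> `|psi x| <= M) -> L1 leb (fun x => f x * psi x).
Proof.
move=> i f0 mpsi psiM; apply: (@L1_dom _ _ _ leb _ (fun x => M * `|f x|)).
- by apply: measurable_funM => //; exact: L1_meas i.
- move=> x; rewrite normrM mulrC.
  have [Bx|nBx] := asboolP (B x); first by rewrite ler_wpM2r// psiM.
  by rewrite f0// normr0 !mulr0.
- by apply: L1Z; exact: L1_norm.
Qed.

(** [wdx] fails at most on a null set of times, and these are integrated out: the time integral has
    a weak derivative at every [t]. *)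
Lemma wdx_volt k u v t (phi : R -> R) : bker k -> suppQ u -> suppQ v ->
  L2 leb2 u -> L2 leb2 v -> wdx u v -> Cc_inf_01 phi ->
  \int[leb]_x (volt k u (t, x) * derive1 phi x) =
  - \int[leb]_x (volt k v (t, x) * phi x).
Proof.
move=> bk su sv iu iv uv Cphi.
have [M HM] := Cc_bounds Cphi.
have mp := Cc_meas Cphi; have mp' := Cc_derive_meas Cphi.
have M1 x : B x -> `|phi x| <= M by move=> /HM[].
have M2 x : B x -> `|derive1 phi x| <= M by move=> /HM[].
rewrite (volt_pair t bk su iu mp' M2) (volt_pair t bk sv iv mp M1).
have iv1 : L1 leb2 (fun z => v z * phi z.2).
  apply: (@L1_dom _ _ _ leb2 _ (fun z => M * `|v z|)).
  - apply: measurable_funM; first by case: iv.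
    by apply: (measurableT_comp mp); exact: measurable_snd.
  - move=> -[s x]/=; rewrite normrM mulrC.
    have [Bx|nBx] := asboolP (B x); first by rewrite ler_wpM2r// M1.
    by rewrite (suppQ_sec1 _ sv nBx) normr0 !mulr0.
  - by apply: L1Z; apply: L1_norm; exact: suppQ_L1.
have i1 := L1_bker t bk (L1_Rint2 iv1).
rewrite -RintN//; apply: Rint_ae_eq.
- apply: measurable_funM; first by apply: meas_section1; case: bk.
  apply: (@meas_Rint2 _ _ _ _ _ leb (fun z => u z * derive1 phi z.2)).
  apply: measurable_funM; first by case: iu.
  by apply: (measurableT_comp mp'); exact: measurable_snd.
- by have := L1_meas (L1N i1).
- apply: (ae_imp (mu := leb) uv) => s uvs.
  by rewrite (uvs phi Cphi) mulrN.
Qed.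

End cylinder.

(** * The energy argument *)

Section energy.
Context {R : realType} (T : R).
Local Notation leb := (@lebesgue_measure R).
Local Notation leb2 := ((@lebesgue_measure R) \x (@lebesgue_measure R))%E.
Local Notation A := (I0T T).
Local Notation B := (@I01 R).
Local Notation mA := (measurable_I0T T).
Local Notation finA := (lebesgue_I0T_lty T).
Local Notation mB := (@measurable_I01 R).
Local Notation finB := (@lebesgue_I01_lty R).
Local Notation bl := (@bker_ltk R).
Local Notation bg := (@bker_gtk R).

Lemma volt_swap_suppA k (u : R * R -> R) (t x : R) : suppQ T u -> ~ A t ->
  volt k (fun z => u (z.2, z.1)) (x, t) = 0.
Proof.
move=> su nA; apply: Rint_eq0 => s /=.
by rewrite (suppQ_sec2 _ su nA) mulr0.
Qed.

(** [g] is minus the integral of [k] over y > x. Moving the kernel onto [phi]' leaves the integral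
    of [phi]' over x < s, which is phi(s). The value of [g] at x = 0 is unrestricted; this freedom
    is where the no-flux condition there is used. *)
Lemma wdx_primitive (k : R * R -> R) : suppQ T k -> L2 leb2 k ->
  let g z := - (\1_B z.2 * volt (transp ltk) (fun z => k (z.2, z.1)) (z.2, z.1)) in
  [/\ suppQ T g, L2 leb2 g & wdx g k].
Proof.
move=> sk ik g.
have sks := suppQ_swap sk; have iks := L2_swap ik.
split.
- move=> -[t x] nQ; rewrite /g/= indicE.
  have [Bx|nBx] := asboolP (B x); last by rewrite memNset// mul0r oppr0.
  rewrite (volt_swap_suppA _ _ sk) ?mulr0 ?oppr0// => At.
  by apply: nQ.
- apply: L2N; exact: (L2_swap (L2_volt mB finB bg sks iks)).
- apply: (ae_imp (mu := leb) (L2_section1 ik)) => t ikt phi Cphi.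
  have [M HM] := Cc_bounds Cphi.
  have M1 x : B x -> `|phi x| <= M by move=> /HM[].
  have M2 x : B x -> `|derive1 phi x| <= M by move=> /HM[].
  have k1 : L1 leb (fun y => k (t, y)).
    by apply: (@L2_L1 _ _ _ leb B) ikt; [exact: mB|exact: finB|move=> x; exact: (suppQ_sec1 t sk)].
  have iI : L1 leb (\1_B : R -> R).
    apply: (@L2_L1 _ _ _ leb B); [exact: mB|exact: finB| |].
      by move=> x nBx; rewrite indicE memNset.
    by apply: L2_indic; [exact: mB|exact: finB].
  have g1 : L1 leb (fun x => \1_B x * derive1 phi x).
    apply: (L1_bounded iI _ (Cc_derive_meas Cphi) M2).
    by move=> x nBx; rewrite indicE memNset.
  have i1 := L1_bounded k1 (fun x => suppQ_sec1 t sk) (Cc_meas Cphi) M1.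
  have := volt_adjoint1 bg k1 g1.
  have -> : \int[leb]_s (k (t, s) * \int[leb]_t0 (transp ltk (t0, s) *
      (\1_B t0 * derive1 phi t0))) = \int[leb]_x (k (t, x) * phi x).
    apply: Rint_eq => s.
    have [Bs|nBs] := asboolP (B s); first by rewrite -[in RHS](Cc_FTC Cphi Bs).
    by rewrite (suppQ_sec1 _ sk nBs) !mul0r.
  move=> <-; rewrite -RintN.
    by apply: Rint_eq => x; rewrite /g/volt/= mulNr mulrAC.
  have msec : meas (fun x => \int[leb]_s (transp ltk (x, s) * k (t, s))).
    apply: (@meas_Rint2 _ _ _ _ _ leb (fun z => transp ltk z * k (t, z.2))).
    apply: measurable_funM; first by case: bg.
    by apply: (measurableT_comp (L1_meas k1)); exact: measurable_snd.
  apply: (@L1_dom _ _ _ leb _ (fun x => (\int[leb]_s `|k (t, s)|) * `|\1_B x * derive1 phi x|)).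
  + by apply: measurable_funM => //; exact: L1_meas g1.
  + move=> x; rewrite normrM mulrC ler_wpM2r//.
    have j := L1_bker x bg k1.
    apply: (le_trans (le_normr_Rintegral measurableT j)).
    apply: Rint_le; [exact: L1_norm|exact: L1_norm|move=> r].
    by rewrite normrM ler_piMl//; apply: bg.2.
  + by apply: L1Z; exact: L1_norm.
Qed.

Variables (U F : R * R -> R).
Hypotheses (sU : suppQ T U) (sF : suppQ T F) (iU : L2 leb2 U) (iF : L2 leb2 F).
Hypothesis Htest : forall g k, suppQ T g -> suppQ T k -> L2 leb2 g -> L2 leb2 k ->
  wdx g k -> \int[leb2]_z (U z * g z) + \int[leb2]_z (k z * volt ltk F z) = 0.

(** By the adjoint in space, testing with the primitive of [k] says that G - Phi is orthogonal to
    [k], where Phi is the space primitive of [U]; choosing k = G - Phi makes its square integrate to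
    zero. *)
Lemma time_primitive_eq_space_primitive :
  {ae leb, forall s, A s -> {ae leb, forall x, B x ->
    volt ltk F (s, x) = \int[leb]_y ((y < x)%R%:R * U (s, y))}}.
Proof.
pose Us z := U (z.2, z.1).
have sUs := suppQ_swap sU; have iUs := L2_swap iU.
pose Phi z := volt ltk Us (z.2, z.1).
(* G does not vanish for t >= T nor Phi for x >= 1, so each needs the indicator of its own
   direction; in the other direction it vanishes along with [F] or [U]. *)
pose k z := \1_A z.1 * volt ltk F z - \1_B z.2 * Phi z.
have sk : suppQ T k.
  move=> -[t x] nQ; rewrite /k/=.
  have [At|nAt] := asboolP (A t); last first.
    by rewrite /Phi/= volt_swap_suppA// indicE memNset// mul0r mulr0 subr0.
  have [Bx|nBx] := asboolP (B x); first by exfalso; apply: nQ.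
  by rewrite (volt_suppB _ _ sF)// [\1_B _]indicE memNset// mul0r mulr0 subr0.
have ik : L2 leb2 k.
  apply: L2B; first exact: (L2_volt mA finA bl (suppQ1 sF) iF).
  exact: (L2_swap (L2_volt mB finB bl sUs iUs)).
have [sg ig wg] := wdx_primitive sk ik.
have := Htest sg sk ig ik wg.
have sks := suppQ_swap sk; have iks := L2_swap ik.
have e1 : \int[leb2]_z (U z * - (\1_B z.2 *
    volt (transp ltk) (fun z => k (z.2, z.1)) (z.2, z.1))) =
    - \int[leb2]_z (k z * Phi z).
  have j1 := L1_mul_volt mB finB bg sks sUs iks iUs.
  have j2 := L1_mul_volt mB finB bl sUs sks iUs iks.
  have := volt_adjoint mB finB bl sUs sks iUs iks.
  rewrite -(Rint_swap j1) -(Rint_swap j2) /= => E.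
  rewrite (_ : \int[leb2]_z (k z * Phi z) = \int[leb2]_z (k (z.1, z.2) * Phi z)); last first.
    by apply: Rint_eq => -[].
  rewrite E -RintN; last by have := L1_swap j1.
  apply: Rint_eq => -[t x]/=; rewrite mulrN; congr (- _).
  rewrite indicE; have [Bx|nBx] := asboolP (B x); first by rewrite mem_set// mul1r.
  by rewrite (suppQ_sec1 _ sU nBx) !mul0r.
rewrite e1 addrC.
have j2 := L1_mul_volt mA finA bl (suppQ1 sF) (suppQ1 sk) iF ik.
have j3 : L1 leb2 (fun z => k z * Phi z).
  have -> : (fun z => k z * Phi z) = (fun z => k (z.1, z.2) * Phi z).
    by apply/funext => -[].
  exact: (L1_swap (L1_mul_volt mB finB bl sUs sks iUs iks)).
rewrite -RintB// => E.
have E2 : \int[leb2]_z (k z ^+ 2) = 0.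
  rewrite -[RHS]E; apply: Rint_eq => -[t x].
  have [[At Bx]|nQ] := asboolP (QT T (t, x)); last by rewrite sk// !mul0r subrr expr0n.
  by rewrite /k/= !indicE !mem_set// !mul1r; ring.
have [mk k2] := ik.
(* Iterated integration turns a null set of the plane into null sections for almost every time, the
   form used slice by slice. *)
rewrite (Fubini_Rint1 k2) in E2.
have E3 := Rint_eq0_ae (L1_Rint2 k2) (fun s => Rint_ge0 leb (fun x => sqr_ge0 (k (s, x)))) E2.
apply: (ae_imp2 (mu := leb) E3 (L1_section1 k2)) => s ks iks' As.
apply: (ae_imp (mu := leb) (Rint_eq0_ae iks' (fun x => sqr_ge0 (k (s, x))) ks)) => x kx Bx.
move/eqP: kx; rewrite sqrf_eq0 /k/= !indicE !mem_set// !mul1r subr_eq0 => /eqP.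
by [].
Qed.

End energy.

(** * The energy inequality and its consequence w = 0 *)

Section uniqueness.
Context {R : realType} (T : R).
Local Notation leb := (@lebesgue_measure R).
Local Notation leb2 := ((@lebesgue_measure R) \x (@lebesgue_measure R))%E.
Local Notation A := (I0T T).
Local Notation B := (@I01 R).
Local Notation mA := (measurable_I0T T).
Local Notation finA := (lebesgue_I0T_lty T).
Local Notation mB := (@measurable_I01 R).
Local Notation finB := (@lebesgue_I01_lty R).
Local Notation bl := (@bker_ltk R).

Variables (U w wx D p F : R * R -> R) (Ch Cb dl : R).
Hypotheses (Ch0 : 0 < Ch) (Cb0 : 0 < Cb) (dl0 : 0 < dl).
Hypotheses (sU : suppQ T U) (sw : suppQ T w) (swx : suppQ T wx) (sp : suppQ T p)
  (sF : suppQ T F).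
Hypotheses (iU : L2 leb2 U) (iw : L2 leb2 w) (iwx : L2 leb2 wx) (ip : L2 leb2 p)
  (iF : L2 leb2 F) (mD : meas D).
Hypothesis FE : forall z, F z = wx z + D z * p z.
Hypothesis Uw : forall z, `|U z| <= Ch * `|w z|.
Hypothesis Dw : forall z, `|D z| <= Cb * `|w z|.
Hypothesis Uw_ge : forall z, dl * w z ^+ 2 <= U z * w z.
Hypothesis wwx : wdx w wx.
Hypothesis im : L1 leb (fun t => (\int[leb]_x (p (t, x) ^+ 2)) ^+ 2).
Hypothesis Htest : forall g k, suppQ T g -> suppQ T k -> L2 leb2 g -> L2 leb2 k ->
  wdx g k -> \int[leb2]_z (U z * g z) + \int[leb2]_z (k z * volt ltk F z) = 0.

Local Notation G := (volt ltk F).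
Let y t := \int[leb]_x (G (t, x) ^+ 2).
Let m t := (\int[leb]_x (p (t, x) ^+ 2)) ^+ 2.
Let a t := \int[leb]_x (w (t, x) ^+ 2).
(** The constant of [slice_estimate] at e = dl / 2, so that Young's inequality uses up only half of
    the coercive term. *)
Let C := (4 * Cb ^+ 4 * Ch ^+ 2) / (4 * (dl / 2) ^+ 3).

Let C0 : 0 < C.
Proof. by rewrite divr_gt0// !mulr_gt0// ?exprn_gt0// divr_gt0. Qed.

Let y_ge0 t : 0 <= y t.
Proof. by apply: Rint_ge0 => x; exact: sqr_ge0. Qed.

Let y_le t : y t <= (\int[leb]_s (\1_A s : R)) * \int[leb2]_z (F z ^+ 2).
Proof. by have [] := volt_row mA finA t bl (suppQ1 sF) iF. Qed.

Let mG : meas G.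
Proof. by apply: meas_volt; [case: bl|case: iF]. Qed.

Let my : meas y.
Proof.
apply: (@meas_Rint2 _ _ _ _ _ leb (fun z => G z ^+ 2)).
exact: measurable_funX.
Qed.

Let ia : L1 leb a.
Proof. by have [_ /L1_Rint2] := iw. Qed.

Let imy : L1 leb (fun s => m s * y s).
Proof.
pose K := (\int[leb]_s (\1_A s : R)) * \int[leb2]_z (F z ^+ 2).
apply: (@L1_dom _ _ _ leb _ (fun s => K * m s)); last exact: L1Z.
  by apply: measurable_funM => //; exact: L1_meas im.
move=> s; have m0 : 0 <= m s by exact: sqr_ge0.
rewrite ger0_norm; last exact: mulr_ge0.
by rewrite [leRHS]mulrC; apply: ler_wpM2l => //; exact: y_le.
Qed.

(** A sharp cut-off in time is admissible in [Htest], which asks for a weak derivative in space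
    only. *)
Let trunc (t : R) (u : R * R -> R) z : R := (z.1 < t)%R%:R * u z.

Let meas_trunc t u : meas u -> meas (trunc t u).
Proof.
move=> mu; apply: measurable_funM => //.
by apply: (measurableT_comp (meas_section1 t bl.1)); exact: measurable_fst.
Qed.

Let trunc_le t u z : `|trunc t u z| <= `|u z|.
Proof. by rewrite /trunc normrM ler_piMl//; exact: (bl.2 (t, z.1)). Qed.

Let L1_trunc t u : L1 leb2 u -> L1 leb2 (trunc t u).
Proof.
move=> i; apply: (@L1_dom _ _ _ leb2 _ (fun z => `|u z|)).
- exact: meas_trunc (L1_meas i).
- exact: trunc_le.
- exact: L1_norm.
Qed.

Let L2_trunc t u : L2 leb2 u -> L2 leb2 (trunc t u).
Proof.
move=> i; apply: (@L2_dom _ _ _ leb2 1 _ u) => //.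
- by apply: meas_trunc; case: i.
- by move=> z; rewrite mul1r; exact: trunc_le.
Qed.

Let supp_trunc t u : suppQ T u -> suppQ T (trunc t u).
Proof. by move=> su z nQ; rewrite /trunc su// mulr0. Qed.

Let iFG : L1 leb2 (fun z => F z * G z).
Proof. exact: (L1_mul_volt mA finA bl (suppQ1 sF) (suppQ1 sF) iF iF). Qed.

Let iwxG : L1 leb2 (fun z => wx z * G z).
Proof. exact: (L1_mul_volt mA finA bl (suppQ1 sF) (suppQ1 swx) iF iwx). Qed.

(** Obtained as a difference, since [F] and [wx] are each square integrable and pair with G; the
    bound of [D] by |w| alone would give no more than integrability of D p. *)
Let iDpG : L1 leb2 (fun z => D z * p z * G z).
Proof.
rewrite (_ : (fun z => D z * p z * G z) = (fun z => F z * G z - wx z * G z)).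
  exact: L1B.
by apply/funext => z; rewrite FE; ring.
Qed.

Let iUw : L1 leb2 (fun z => U z * w z).
Proof. exact: L2M. Qed.

(** [primitive_sqr] on almost every line x = const, then integrated in x; it holds at every [t]. *)
Let y_eq t : y t = 2 * \int[leb2]_z (trunc t (fun z => F z * G z) z).
Proof.
have i1 := L1_trunc t iFG.
rewrite (Fubini_Rint2 i1) -RintZ; last exact: L1_Rint1 i1.
apply: Rint_ae_eq.
- by apply: measurable_funX; exact: meas_section1.
- by have := L1_meas (L1Z 2 (L1_Rint1 i1)).
- apply: (ae_imp (mu := leb) (L1_section2 (suppQ_L1 sF iF))) => x Fx.
  exact: (primitive_sqr t Fx).
Qed.

(** [Htest] with g = 1_{s<t} w and k = 1_{s<t} wx. *)
Let wxG_eq t : \int[leb2]_z (trunc t (fun z => wx z * G z) z) =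
  - \int[leb2]_z (trunc t (fun z => U z * w z) z).
Proof.
have wt : wdx (trunc t w) (trunc t wx).
  apply: (ae_imp2 (mu := leb) wwx (aeW leb (fun s : R => erefl s))) => s ws _ phi Cphi.
  have [st|st] := boolP (s < t).
    have e v x : trunc t v (s, x) = v (s, x) by rewrite /trunc/= st mul1r.
    rewrite (Rint_eq leb (fun x => congr1 (fun r => r * _) (e w x))) ws//.
    by congr (- _); apply: Rint_eq => x; rewrite e.
  have e v x : trunc t v (s, x) = 0 by rewrite /trunc/= (negbTE st) mul0r.
  rewrite [LHS]Rint_eq0 => [|x]; last by rewrite e mul0r.
  by rewrite [X in _ = - X]Rint_eq0 ?oppr0// => x; rewrite e mul0r.
have := Htest (supp_trunc t sw) (supp_trunc t swx) (L2_trunc t iw) (L2_trunc t iwx) wt.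
move/eqP; rewrite addr_eq0 => /eqP E.
rewrite (_ : \int[leb2]_z (trunc t (fun z => U z * w z) z) =
  \int[leb2]_z (U z * trunc t w z)); last first.
  by apply: Rint_eq => z; rewrite /trunc; ring.
by rewrite E opprK; apply: Rint_eq => z; rewrite /trunc mulrA.
Qed.

(** Coercivity bounds the integral of U w below by dl * a s; half of this pays for the term that
    [slice_estimate] leaves on [a]. *)
Let slice : {ae leb, forall s,
  \int[leb]_x (D (s, x) * p (s, x) * G (s, x)) - \int[leb]_x (U (s, x) * w (s, x))
  <= C * (m s * y s) - dl / 2 * a s}.
Proof.
have GE := time_primitive_eq_space_primitive sU sF iU iF Htest.
have aeL2 := ae_imp2 (mu := leb) (L2_section1 iU) (L2_section1 iw)
  (fun _ h1 h2 => conj h1 h2).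
have aeL2p := ae_imp2 (mu := leb) aeL2 (L2_section1 ip) (fun _ h1 h2 => conj h1 h2).
apply: (ae_imp2 (mu := leb) GE aeL2p) => s GEs [[iUs iws] ips].
have [As|nAs] := asboolP (A s); last first.
  have p0 x : p (s, x) = 0 by exact: suppQ_sec2 sp nAs.
  have w0 x : w (s, x) = 0 by exact: suppQ_sec2 sw nAs.
  have -> : m s = 0.
    by rewrite /m Rint_eq0 ?expr0n// => x; rewrite p0 expr0n.
  have -> : a s = 0.
    by apply: Rint_eq0 => x; rewrite w0 expr0n.
  have -> : \int[leb]_x (D (s, x) * p (s, x) * G (s, x)) = 0.
    by apply: Rint_eq0 => x; rewrite p0 mulr0 mul0r.
  have -> : \int[leb]_x (U (s, x) * w (s, x)) = 0.
    by apply: Rint_eq0 => x; rewrite w0 mulr0.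
  by rewrite mul0r !mulr0.
have [iGs _] := volt_row mA finA s bl (suppQ1 sF) iF.
have := slice_estimate mB finB (divr_gt0 dl0 (ltr0n R 2)) (ltW Ch0) (ltW Cb0)
  iUs iws ips iGs (meas_section1 s mD) (fun x => suppQ_sec1 s sw)
  (fun x => Uw (s, x)) (fun x => Dw (s, x)) (GEs As).
have : dl * a s <= \int[leb]_x (U (s, x) * w (s, x)).
  have i1 := L2M iUs iws; have [_ i2] := iws.
  rewrite -RintZ//; by apply: Rint_le => //; exact: L1Z.
rewrite -/(a s) -/(m s) -/(y s) -/C.
lra.
Qed.

Let energy t : y t <= 2 * (C * \int[leb]_s ((s < t)%R%:R * (m s * y s)) -
  dl / 2 * \int[leb]_s ((s < t)%R%:R * a s)).
Proof.
rewrite y_eq ler_wpM2l//.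
have i1 := L1_trunc t iwxG; have i2 := L1_trunc t iDpG; have i3 := L1_trunc t iUw.
have -> : \int[leb2]_z trunc t (fun z => F z * G z) z =
    \int[leb2]_z (trunc t (fun z => D z * p z * G z) z - trunc t (fun z => U z * w z) z).
  rewrite RintB// -[X in _ - X]opprK -wxG_eq opprK -RintD//.
  by apply: Rint_eq => z; rewrite /trunc FE; ring.
have i4 := L1B i2 i3.
rewrite (Fubini_Rint1 i4).
have j1 := L1_bker t bl imy; have j2 := L1_bker t bl ia.
rewrite -RintZ// -RintZ// -RintB; [|exact: L1Z|exact: L1Z].
apply: Rint_ae_le; [exact: L1_Rint2 i4|by apply: L1B; exact: L1Z|].
have ae2 := ae_imp2 (mu := leb) (L1_section1 iDpG) (L1_section1 iUw)
  (fun _ h1 h2 => conj h1 h2).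
apply: (ae_imp2 (mu := leb) slice ae2) => s sl [k1 k2].
rewrite (_ : \int[leb]_x _ = (s < t)%R%:R * (\int[leb]_x (D (s, x) * p (s, x) * G (s, x))
   - \int[leb]_x (U (s, x) * w (s, x)))); last first.
  rewrite -RintB// -RintZ; last exact: L1B.
  by apply: Rint_eq => x; rewrite /trunc/= mulrBr.
rewrite (_ : C * _ - _ = (s < t)%R%:R * (C * (m s * y s) - dl / 2 * a s)); last first.
  by rewrite /ltk/=; ring.
by rewrite ler_wpM2l.
Qed.

Lemma energy_uniqueness : \int[leb2]_z (w z ^+ 2) = 0.
Proof.
have a0 s : 0 <= a s by apply: Rint_ge0 => x; exact: sqr_ge0.
have m0 s : 0 <= m s by exact: sqr_ge0.
have Ia0 t : 0 <= \int[leb]_s ((s < t)%R%:R * a s).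
  by apply: Rint_ge0 => s; rewrite mulr_ge0.
have gr := @gronwall R m y _ (2 * C) im m0 _ my (fun t => introT andP (conj (y_ge0 t) (y_le t))).
have {}gr t : \int[leb]_s ((s < t)%R%:R * (m s * y s)) = 0.
  apply: gr.
  - move=> s s0; rewrite /m Rint_eq0 ?expr0n// => x; rewrite (suppQ_sec2 _ sp) ?expr0n//.
    by rewrite /I0T/= in_itv/= => /andP[]; rewrite ltNge s0.
  - by rewrite mulr_gt0.
  - move=> t'; apply: (le_trans (energy t')); rewrite mulrBr mulrA.
    by rewrite lerBlDr lerDl mulr_ge0// mulr_ge0// ltW// divr_gt0.
(* Gronwall's lemma was applied with the dissipation term dropped. Once the term in m y is known to
   vanish, the full inequality at [T] bounds the dissipation by 0. *)
have := energy T; rewrite gr mulr0 sub0r => H.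
have Ia : \int[leb]_s ((s < T)%R%:R * a s) = 0.
  apply/eqP; rewrite eq_le Ia0 andbT.
  have := le_trans (y_ge0 T) H.
  by rewrite pmulr_rge0// oppr_ge0 pmulr_rle0// divr_gt0.
have [_ iw2] := iw.
rewrite (Fubini_Rint1 iw2) -[RHS]Ia; apply: Rint_eq => s.
have [|sT] := ltP s T; first by rewrite mul1r.
rewrite mul0r Rint_eq0// => x; rewrite (suppQ_sec2 _ sw) ?expr0n//.
by rewrite /I0T/= in_itv/= => /andP[_]; rewrite ltNge sT.
Qed.

End uniqueness.

(** * Zero extension and the weak formulation *)

Section zero_extension.
Context {R : realType} (T : R).
Local Notation leb := (@lebesgue_measure R).
Local Notation leb2 := ((@lebesgue_measure R) \x (@lebesgue_measure R))%E.
Local Notation A := (I0T T).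
Local Notation B := (@I01 R).
Local Notation Q := (QT T).
Local Notation mA := (measurable_I0T T).
Local Notation finA := (lebesgue_I0T_lty T).
Local Notation mB := (@measurable_I01 R).
Local Notation finB := (@lebesgue_I01_lty R).
Local Notation bl := (@bker_ltk R).
Local Notation bg := (@bker_gtk R).
Implicit Types (u v : R -> R -> R) (f g k : R * R -> R).

Lemma measurable_QT : measurable Q.
Proof. by apply: measurableX; [exact: mA|exact: mB]. Qed.

Definition zext f : R * R -> R := f \_ Q.

Lemma zext_in f z : Q z -> zext f z = f z.
Proof. by move=> Qz; rewrite /zext patchE mem_set. Qed.

Lemma zext_out f z : ~ Q z -> zext f z = 0.
Proof. by move=> nQz; rewrite /zext patchE memNset. Qed.

Lemma suppQ_zext f : suppQ T (zext f).
Proof. exact: zext_out. Qed.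

Lemma meas_zext f : measurable_fun Q f -> meas (zext f).
Proof. by move=> mf; apply/(measurable_restrictT _ measurable_QT). Qed.

Lemma L2_zext u : L2_Q T u -> L2 leb2 (zext (fun z => u z.1 z.2)).
Proof.
move=> [mu iu]; have mz := meas_zext mu; split => //.
apply/integrableP; split; first by apply/measurable_EFinP; exact: measurable_funX.
apply: le_lt_trans iu; rewrite [leRHS]integral_mkcond le_eqVlt; apply/orP; left.
apply/eqP; apply: eq_integral => z _ /=; rewrite patchE /zext patchE.
case: ifPn => _; first by rewrite ger0_norm// sqr_ge0.
by rewrite expr0n normr0.
Qed.

Lemma Rint_QT f g : (forall z, Q z -> f z = g z) -> (forall z, ~ Q z -> g z = 0) ->
  \int[leb2]_(z in Q) f z = \int[leb2]_z g z.
Proof.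
move=> fg g0; rewrite Rintegral_mkcond; apply: Rint_eq => z; rewrite patchE.
have [Qz|nQz] := asboolP (Q z); first by rewrite mem_set// fg.
by rewrite memNset// g0.
Qed.

(** [f] and [g] need agree only on Q(T): a time primitive is square integrable on the plane only
    after multiplication by an indicator. *)
Lemma L2_Q_of f g : meas f -> L2 leb2 g -> (forall z, Q z -> f z = g z) ->
  L2_Q T (fun t x => f (t, x)).
Proof.
move=> mf [mg /integrableP[_ ig]] fg.
rewrite /L2_Q (_ : (fun z => f (z.1, z.2)) = f); last by apply/funext => -[].
split; first exact: measurable_funTS.
apply: le_lt_trans ig.
have -> : (\int[leb2]_(z in Q) (f (z.1, z.2) ^+ 2)%:E =
    \int[leb2]_(z in Q) `|(EFin \o (fun z : R * R => (g z ^+ 2)%R)) z|)%E.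
  apply: eq_integral => -[t x]; rewrite inE => Qz /=.
  by rewrite fg// ger0_norm// sqr_ge0.
apply: ge0_subset_integral => //; first exact: measurable_QT.
by apply: measurableT_comp => //; apply/measurable_EFinP; exact: measurable_funX.
Qed.

Lemma integral_I01 (f : R -> R) : (forall x, ~ B x -> f x = 0) ->
  (\int[leb]_(x in B) (f x)%:E = \int[leb]_x (f x)%:E)%E.
Proof.
move=> f0; rewrite integral_mkcond; apply: eq_integral => x _; rewrite patchE.
have [Bx|nBx] := asboolP (B x); first by rewrite mem_set.
by rewrite memNset// f0.
Qed.

Lemma wdx_zext u v : weak_dx T u v ->
  wdx (zext (fun z => u z.1 z.2)) (zext (fun z => v z.1 z.2)).
Proof.
move=> [_ ae]; apply: (ae_imp (mu := leb) ae) => t H phi Cphi.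
have [At|nAt] := asboolP (A t); last first.
  rewrite !Rint_eq0 ?oppr0// => x; rewrite zext_out ?mul0r//; by case.
have := congr1 fine (H At phi Cphi); rewrite fineN => E.
have e (f : R -> R -> R) (psi : R -> R) :
    \int[leb]_(x in B) (f t x * psi x) =
    \int[leb]_x (zext (fun z => f z.1 z.2) (t, x) * psi x).
  rewrite Rintegral_mkcond; apply: Rint_eq => x; rewrite patchE.
  have [Bx|nBx] := asboolP (B x).
    by rewrite mem_set// zext_in.
  by rewrite memNset// zext_out ?mul0r// => -[].
by rewrite -!e.
Qed.

(** Splitting the integrals needs integrable sections; these come, for almost every [t], from square
    integrability and bounded support. *)
Lemma wdxB f1 f2 g1 g2 : suppQ T f1 -> suppQ T f2 -> suppQ T g1 -> suppQ T g2 ->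
  L2 leb2 f1 -> L2 leb2 f2 -> L2 leb2 g1 -> L2 leb2 g2 ->
  wdx f1 g1 -> wdx f2 g2 -> wdx (fun z => f1 z - f2 z) (fun z => g1 z - g2 z).
Proof.
move=> sf1 sf2 sg1 sg2 if1 if2 ig1 ig2 w1 w2.
have i1 := ae_imp2 (mu := leb) (L1_section1 (suppQ_L1 sf1 if1))
  (L1_section1 (suppQ_L1 sf2 if2)) (fun _ h1 h2 => conj h1 h2).
have i2 := ae_imp2 (mu := leb) (L1_section1 (suppQ_L1 sg1 ig1))
  (L1_section1 (suppQ_L1 sg2 ig2)) (fun _ h1 h2 => conj h1 h2).
have i3 := ae_imp2 (mu := leb) i1 i2 (fun _ h1 h2 => conj h1 h2).
have w3 := ae_imp2 (mu := leb) w1 w2 (fun _ h1 h2 => conj h1 h2).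
apply: (ae_imp2 (mu := leb) i3 w3) => t [[h1 h2] [h3 h4]] [e1 e2] phi Cphi.
have [M HM] := Cc_bounds Cphi.
have M1 x : B x -> `|phi x| <= M by move=> /HM[].
have M2 x : B x -> `|derive1 phi x| <= M by move=> /HM[].
have mp := Cc_meas Cphi; have mp' := Cc_derive_meas Cphi.
have j1 := L1_bounded h1 (fun x => suppQ_sec1 t sf1) mp' M2.
have j2 := L1_bounded h2 (fun x => suppQ_sec1 t sf2) mp' M2.
have j3 := L1_bounded h3 (fun x => suppQ_sec1 t sg1) mp M1.
have j4 := L1_bounded h4 (fun x => suppQ_sec1 t sg2) mp M1.
rewrite (Rint_eq leb (fun x => mulrBl (derive1 phi x) (f1 (t, x)) (f2 (t, x)))).
rewrite (Rint_eq leb (fun x => mulrBl (phi x) (g1 (t, x)) (g2 (t, x)))).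
by rewrite !RintB// (e1 _ Cphi) (e2 _ Cphi) opprD opprK addrC.
Qed.

(** The test function is eta(t) = - \int_t^T g. It vanishes at T because [g] does beyond T, and
    [wdx_volt] provides its space derivative. *)
Lemma test_fun_volt g k : suppQ T g -> suppQ T k -> L2 leb2 g -> L2 leb2 k ->
  wdx g k ->
  test_fun T (fun t x => - volt (transp ltk) g (t, x)) (fun t x => g (t, x))
    (fun t x => - volt (transp ltk) k (t, x)).
Proof.
move=> sg sk ig ik gk.
have LQ f : suppQ T f -> L2 leb2 f ->
    L2_Q T (fun t x => - volt (transp ltk) f (t, x)).
  move=> sf if_.
  apply: (@L2_Q_of (fun z => - volt (transp ltk) f z)
    (fun z => - (\1_A z.1 * volt (transp ltk) f z))).
  - by apply: measurableT_comp => //; apply: meas_volt; [case: bg|case: if_].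
  - by apply: L2N; exact: (L2_volt mA finA bg (suppQ1 sf) if_).
  - by move=> -[t x] [/= At _]; rewrite indicE mem_set// mul1r.
have row f t : suppQ T f -> L2 leb2 f -> L2 leb (fun x => volt (transp ltk) f (t, x)).
  by move=> sf if_; have [] := volt_row mA finA t bg (suppQ1 sf) if_.
have row1 f t : suppQ T f -> L2 leb2 f -> L1 leb (fun x => - volt (transp ltk) f (t, x)).
  move=> sf if_; apply: L1N; apply: (@L2_L1 _ _ _ leb B _ mB finB) (row f t sf if_).
  by move=> x; exact: (volt_suppB _ _ sf).
split; first exact: LQ.
split; first by apply: (@L2_Q_of g g) => //; case: ig.
split.
  split; first exact: LQ.
  apply: aeW => t At phi Cphi.
  have [M HM] := Cc_bounds Cphi.
  have M1 x : B x -> `|phi x| <= M by move=> /HM[].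
  have M2 x : B x -> `|derive1 phi x| <= M by move=> /HM[].
  have mp := Cc_meas Cphi; have mp' := Cc_derive_meas Cphi.
  have v0 f x : suppQ T f -> ~ B x -> - volt (transp ltk) f (t, x) = 0.
    by move=> sf nB; rewrite (volt_suppB _ _ sf nB) oppr0.
  have j1 := L1_bounded (row1 g t sg ig) (fun x => v0 g x sg) mp' M2.
  have j2 := L1_bounded (row1 k t sk ik) (fun x => v0 k x sk) mp M1.
  rewrite integral_I01; last by move=> x nB; rewrite v0// mul0r.
  rewrite integral_I01; last by move=> x nB; rewrite v0// mul0r.
  rewrite (L1_EFin j1) (L1_EFin j2) -EFinN; congr (_%:E).
  have := wdx_volt t bg sg sk ig ik gk Cphi.
  have r1 (f : R * R -> R) (psi : R -> R) :
      \int[leb]_x (- volt (transp ltk) f (t, x) * psi x) =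
      \int[leb]_x (-1 * (volt (transp ltk) f (t, x) * psi x)).
    by apply: Rint_eq => x; rewrite mulN1r mulNr.
  have {}j1 : L1 leb (fun x => volt (transp ltk) g (t, x) * derive1 phi x).
    by have := L1N j1; under eq_fun do rewrite mulNr opprK.
  have {}j2 : L1 leb (fun x => volt (transp ltk) k (t, x) * phi x).
    by have := L1N j2; under eq_fun do rewrite mulNr opprK.
  by rewrite !r1 !RintZ// => ->; ring.
split.
  have [m0 i0] := row g 0 sg ig.
  split; first by apply: measurable_funTS; exact: measurableT_comp.
  rewrite integral_I01; last by move=> x nB; rewrite (volt_suppB _ _ sg nB) oppr0 expr0n.
  under eq_integral do rewrite sqrrN.
  by rewrite (L1_EFin i0) ltry.
split.
  move=> t /andP[t0 tT].
  apply: (ae_imp (mu := leb) (L1_section2 (suppQ_L1 sg ig))) => x gx Bx.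
  rewrite /volt/= [X in _ = _ + X]Rintegral_mkcond.
  have j0 := L1_bker 0 bg gx; have jt := L1_bker t bg gx.
  (* The difference of the kernels 1_{0<s} and 1_{t<s} is the indicator of ]0, t]; at the remaining
     point s = 0 of [0, t] the function [g] vanishes. *)
  rewrite [X in _ + X](_ : _ = \int[leb]_s (transp ltk (0, s) * g (s, x)) -
    \int[leb]_s (transp ltk (t, s) * g (s, x))); first by rewrite addKr.
  rewrite -RintB//; apply: Rint_eq => s; rewrite patchE mem_setE /= in_itv/= /transp /ltk/=.
  have [s0|s0] := ltP 0 s.
    rewrite (ltW s0)/=; have [ts|st] := ltP t s; first by rewrite subrr.
    by rewrite mul1r mul0r subr0.
  rewrite (_ : g (s, x) = 0) ?mulr0 ?subr0 ?if_same//.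
  by apply: sg => -[/=]; rewrite /I0T/= in_itv/= ltNge s0.
apply: aeW => x Bx; rewrite /volt/= Rint_eq0 ?oppr0// => s.
rewrite /transp /ltk/=; have [Ts|_] := ltP T s; last by rewrite mul0r.
rewrite (suppQ_sec2 _ sg) ?mulr0// /I0T/= in_itv/= => /andP[_].
by rewrite ltNge (ltW Ts).
Qed.

End zero_extension.

(** * Integrability of the nonlinear terms and of p *)

Section data.
Context {R : realType} (T : R).
Local Notation leb := (@lebesgue_measure R).
Local Notation leb2 := ((@lebesgue_measure R) \x (@lebesgue_measure R))%E.
Local Notation A := (I0T T).
Local Notation B := (@I01 R).
Local Notation Q := (QT T).

Lemma mean_value (f : R -> R) : (forall x, derivable f x 1) ->
  forall x y, exists c, f x - f y = derive1 f c * (x - y).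
Proof.
move=> df.
have H x y : x < y -> exists c, f y - f x = derive1 f c * (y - x).
  move=> xy; have [||c _ E] := @MVT R f (derive1 f) x y xy.
  - by move=> z _; split; [exact: df|rewrite derive1E].
  - by apply: continuous_subspaceT; exact: derivable_continuous.
  by exists c.
move=> x y; have [/H[c E]|/H[c E]|->] := ltgtP x y.
- by exists c; rewrite -opprB E -mulrN opprB.
- by exists c.
- by exists 0; rewrite !subrr mulr0.
Qed.

(** |h(v)| <= |h(0)| + C |v|, and constants are square integrable on Q(T), which has finite
    measure. *)
Lemma L2_Q_lipschitz (h : R -> R) (C : R) (v : R -> R -> R) :
  (forall x, derivable h x 1) -> (forall x, `|derive1 h x| <= C) ->
  L2_Q T v -> L2 leb2 (zext T (fun z => h (v z.1 z.2))).
Proof.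
move=> dh hC iv; have iz := L2_zext iv; have [mv _] := iv.
have mh : meas h by exact: continuous_measurable_fun (derivable_continuous dh).
pose w z := `|h 0| * \1_Q z + C * `|zext T (fun z => v z.1 z.2) z|.
have iw : L2 leb2 w.
  apply: L2D; apply: L2Z.
    apply: L2_indic; first exact: measurable_QT.
    rewrite [ltLHS]product_measure1E; [|exact: measurable_I0T|exact: measurable_I01].
    rewrite lte_mul_pinfty//; last exact: lebesgue_I01_lty.
    by rewrite ge0_fin_numE//; exact: lebesgue_I0T_lty.
  apply: (@L2_dom _ _ _ leb2 1 _ (zext T (fun z => v z.1 z.2))) => //.
    by apply: measurableT_comp => //; case: iz.
  by move=> z; rewrite normr_id mul1r.
have C0 : 0 <= C by apply: le_trans (hC 0).
apply: (@L2_dom _ _ _ leb2 1 _ w) => //.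
  apply: meas_zext.
  exact: measurableT_comp.
move=> z; rewrite mul1r (@le_trans _ _ (w z))// ?ler_norm// /w.
have [Qz|nQz] := asboolP (Q z); last by rewrite zext_out// normr0 addr_ge0// mulr_ge0.
rewrite !zext_in// indicE mem_set// mulr1.
have [c E] := mean_value dh (v z.1 z.2) 0.
rewrite -(subrK (h 0) (h _)) addrC E subr0; apply: (le_trans (ler_normD _ _)).
by rewrite lerD2l normrM ler_wpM2r.
Qed.

Lemma L4_L2_data (p : R -> R -> R) : L4_L2 T p ->
  L2 leb2 (zext T (fun z => p z.1 z.2)) /\
  L1 leb (fun t => (\int[leb]_x (zext T (fun z => p z.1 z.2) (t, x) ^+ 2)) ^+ 2).
Proof.
move=> [mp ip].
have mz := meas_zext mp; set P := zext T _ in mz *.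
have sP : suppQ T P by exact: suppQ_zext.
have mP2 : meas (fun z => P z ^+ 2) by exact: measurable_funX.
pose q t := (\int[leb]_x (P (t, x) ^+ 2)%:E)%E.
have q0 t : (0 <= q t)%E by apply: integral_ge0 => x _; rewrite lee_fin sqr_ge0.
have mq : measurable_fun setT q.
  apply: (@measurable_fun_fubini_tonelli_F _ _ _ _ _ leb (EFin \o (fun z => P z ^+ 2))).
    by apply/measurable_EFinP.
  by move=> z /=; rewrite lee_fin sqr_ge0.
have qE t : A t -> q t = (\int[leb]_(x in B) (p t x ^+ 2)%:E)%E.
  move=> At; rewrite integral_mkcond; apply: eq_integral => x _; rewrite patchE.
  have [Bx|nBx] := asboolP (B x); first by rewrite mem_set// /P zext_in.
  by rewrite memNset// (suppQ_sec1 _ sP)// expr0n.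
have qout t : ~ A t -> q t = 0%E.
  by move=> nAt; rewrite /q integral0_eq// => x _; rewrite (suppQ_sec2 _ sP)// expr0n.
have iqq : (\int[leb]_t (q t * q t) < +oo)%E.
  apply: le_lt_trans ip; rewrite [leRHS]integral_mkcond le_eqVlt; apply/orP; left.
  apply/eqP/eq_integral => t _; rewrite patchE.
  have [At|nAt] := asboolP (A t); first by rewrite mem_set// qE.
  by rewrite memNset// qout// mule0.
have mqq : measurable_fun setT (fun t => q t * q t)%E by exact: emeasurable_funM.
split.
  split => //; apply/integrable12ltyP; first exact/measurable_EFinP.
  (* Square integrability on Q(T) follows from q <= 1 + q^2 on the bounded interval (0,T). *)
  apply: (@le_lt_trans _ _ (\int[leb]_t ((\1_A t)%:E + q t * q t))%E).
    apply: ge0_le_integral => //.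
    - by move=> t _; exact: integral_ge0.
    - rewrite (_ : (fun t => _) = q)//; apply/funext => t; apply: eq_integral => x _ /=.
      by rewrite ger0_norm// sqr_ge0.
    - apply: emeasurable_funD => //; apply/measurable_EFinP.
      exact: measurable_indic (measurable_I0T T).
    - move=> t _; rewrite (_ : (\int[_]_y _ = q t)%E); last first.
        by apply: eq_integral => x _ /=; rewrite ger0_norm// sqr_ge0.
      have [At|nAt] := asboolP (A t); last by rewrite qout// mule0 adde0.
      rewrite indicE mem_set//; have := q0 t; case: (q t) => [r| |]//=.
      rewrite !lee_fin => r0.
      by have := sqr_ge0 (r - 1); rewrite sqrrB1; nra.
  rewrite ge0_integralD//.
  - rewrite lte_add_pinfty//.
    rewrite integral_indic//; last exact: measurable_I0T.
    by rewrite setIT; exact: lebesgue_I0T_lty.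
  - apply/measurable_EFinP; exact: measurable_indic (measurable_I0T T).
  - by move=> t _; rewrite mule_ge0.
apply/integrableP; split.
  apply/measurable_EFinP; apply: measurable_funX.
  exact: (@meas_Rint2 _ _ _ _ _ leb (fun z => P z ^+ 2)).
apply: le_lt_trans iqq; apply: ge0_le_integral => //.
- apply: measurableT_comp => //; apply/measurable_EFinP; apply: measurable_funX.
  exact: (@meas_Rint2 _ _ _ _ _ leb (fun z => P z ^+ 2)).
- move=> t _ /=; rewrite ger0_norm ?sqr_ge0// /Rintegral -/(q t).
  (* Where q t is infinite the real-valued integral is 0 by convention, which only helps the
     comparison. *)
  have := q0 t; case: (q t) => [r| |]//= _.
  by rewrite expr0n mulyy leey.
Qed.

End data.

(** * The weak formulation in terms of primitives *)

Section weak_form.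
Context {R : realType} (T : R).
Local Notation leb := (@lebesgue_measure R).
Local Notation leb2 := ((@lebesgue_measure R) \x (@lebesgue_measure R))%E.
Local Notation mA := (measurable_I0T T).
Local Notation finA := (lebesgue_I0T_lty T).
Local Notation bl := (@bker_ltk R).
Local Notation bg := (@bker_gtk R).

(** The adjoint identity moves the backward integral off [k] and onto the flux as a forward one. The
    number [c] stands for the initial-data term and stays opaque, so that it cancels between two
    solutions. *)
Lemma weak_form_volt (H P g k : R * R -> R) (H' P' : R * R -> R) (c : R) :
  suppQ T g -> suppQ T k -> suppQ T P -> L2 leb2 g -> L2 leb2 k -> L2 leb2 P ->
  H = zext T H' -> P = zext T P' ->
  - Rintegral leb2 (QT T) (fun z => H' z * g (z.1, z.2)) +
    Rintegral leb2 (QT T) (fun z => P' z * - volt (transp ltk) k (z.1, z.2)) = c ->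
  \int[leb2]_z (H z * g z) + \int[leb2]_z (k z * volt ltk P z) = - c.
Proof.
move=> sg sk sP ig ik iP HE PE <-.
rewrite (@Rint_QT _ _ _ (fun z => H z * g z)); last 2 first.
  by move=> [t x] Qz /=; rewrite HE zext_in.
  by move=> z nQz; rewrite sg// mulr0.
rewrite (@Rint_QT _ _ _ (fun z => - (P z * volt (transp ltk) k z))); last 2 first.
  by move=> [t x] Qz /=; rewrite PE zext_in// mulrN.
  by move=> z nQz; rewrite sP// mul0r oppr0.
rewrite RintN; last exact: (L1_mul_volt mA finA bg (suppQ1 sk) (suppQ1 sP) ik iP).
by rewrite -opprD opprK (volt_adjoint mA finA bl (suppQ1 sP) (suppQ1 sk) iP ik).
Qed.

(** Passing to the adjoint puts P1 - P2 outside the operator, where linearity is pointwise and does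
    not depend on integrable sections. *)
Lemma volt_subr (k P1 P2 : R * R -> R) : suppQ T P1 -> suppQ T P2 -> suppQ T k ->
  L2 leb2 P1 -> L2 leb2 P2 -> L2 leb2 k ->
  \int[leb2]_z (k z * volt ltk (fun z => P1 z - P2 z) z) =
  \int[leb2]_z (k z * volt ltk P1 z) - \int[leb2]_z (k z * volt ltk P2 z).
Proof.
move=> s1 s2 sk i1 i2 ik.
have s3 : suppQ T (fun z => P1 z - P2 z) by move=> z nQ; rewrite s1// s2// subrr.
have adj P (sP : suppQ T P) (iP : L2 leb2 P) :=
  volt_adjoint mA finA bl (suppQ1 sP) (suppQ1 sk) iP ik.
have L1a P (sP : suppQ T P) (iP : L2 leb2 P) :=
  L1_mul_volt mA finA bg (suppQ1 sk) (suppQ1 sP) ik iP.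
rewrite (adj _ s3 (L2B i1 i2)) (adj _ s1 i1) (adj _ s2 i2).
rewrite -RintB; [|exact: L1a|exact: L1a].
by apply: Rint_eq => z; rewrite mulrBl.
Qed.

End weak_form.

(** * Uniqueness for two weak solutions *)

Section uniqueness_of_weak_solutions.
Context {R : realType}.
Local Notation leb2 := ((@lebesgue_measure R) \x (@lebesgue_measure R))%E.

Lemma weak_solution_unique (T : R) (h b : R -> R) (p : R -> R -> R)
    (v0 : R -> R) :
  A1 h -> A2 b -> L4_L2 T p ->
  forall v1 v2 : R -> R -> R,
    weak_solution T h b p v0 v1 -> weak_solution T h b p v0 v2 ->
    {ae leb2,
       forall z : R * R, QT T z -> v1 z.1 z.2 = v2 z.1 z.2}.
Proof.
move=> [[dh _] [dl [Ch [dl0 [Ch0 hbd]]]]] [[db _] [db_ [Cb [db0 [Cb0 bbd]]]]].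
move=> p4 v1 v2 [_ [iv1 [vx1 [wv1 e1]]]] [_ [iv2 [vx2 [wv2 e2]]]].
have [iP im] := L4_L2_data p4.
pose cu (u : R -> R -> R) (z : R * R) := u z.1 z.2.
pose V1 := zext T (cu v1); pose V2 := zext T (cu v2).
pose X1 := zext T (cu vx1); pose X2 := zext T (cu vx2).
pose P := zext T (cu p).
have iV1 : L2 leb2 V1 by exact: L2_zext iv1.
have iV2 : L2 leb2 V2 by exact: L2_zext iv2.
have iX1 : L2 leb2 X1 by exact: L2_zext wv1.1.
have iX2 : L2 leb2 X2 by exact: L2_zext wv2.1.
have hC x : `|derive1 h x| <= Ch.
  have [/andP[l1 l2] _] := hbd x; rewrite ger0_norm//.
  by rewrite (le_trans _ l1)// ltW.
pose H1 := zext T (fun z => h (v1 z.1 z.2)).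
pose H2 := zext T (fun z => h (v2 z.1 z.2)).
have iH1 : L2 leb2 H1 by exact: L2_Q_lipschitz dh hC iv1.
have iH2 : L2 leb2 H2 by exact: L2_Q_lipschitz dh hC iv2.
have mb : meas b by exact: continuous_measurable_fun (derivable_continuous db).
have mbv v : L2_Q T v -> meas (zext T (fun z => b (v z.1 z.2))).
  by move=> [mv _]; apply: meas_zext; exact: measurableT_comp.
pose b1 := zext T (fun z => b (v1 z.1 z.2)).
pose b2 := zext T (fun z => b (v2 z.1 z.2)).
have mb1 : meas b1 by exact: mbv.
have mb2 : meas b2 by exact: mbv.
have bC x : `|b x| <= Cb.
  have [/andP[l1 l2] _] := bbd x; rewrite ger0_norm//.
  by rewrite (le_trans _ l1)// ltW.
pose F' v vx (z : R * R) := vx z.1 z.2 + b (v z.1 z.2) * p z.1 z.2.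
have FE v vx z : zext T (F' v vx) z =
    zext T (cu vx) z + zext T (fun z => b (v z.1 z.2)) z * P z.
  have [Qz|nQz] := asboolP (QT T z); first by rewrite /P !zext_in.
  by rewrite /P !zext_out// mul0r addr0.
have iF v vx : L2_Q T v -> L2_Q T vx ->
    L2 leb2 (zext T (F' v vx)).
  move=> iv ivx; rewrite (_ : zext T (F' v vx) = (fun z => zext T (cu vx) z +
    zext T (fun z => b (v z.1 z.2)) z * P z)); last by apply/funext => z; exact: FE.
  apply: L2D; first exact: L2_zext ivx.
  (* The bound on [b] keeps b(v) p square integrable, so the whole flux is an admissible [F]. *)
  apply: (L2_dom (C := Cb) _ _ iP).
    by apply: measurable_funM; [exact: mbv|case: iP].
  move=> z; rewrite normrM ler_wpM2r//.
  have [Qz|nQz] := asboolP (QT T z); first by rewrite zext_in.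
  by rewrite zext_out// normr0 ltW.
pose F1 := zext T (F' v1 vx1); pose F2 := zext T (F' v2 vx2).
have iF1 : L2 leb2 F1 by exact: iF v1 vx1 iv1 wv1.1.
have iF2 : L2 leb2 F2 by exact: iF v2 vx2 iv2 wv2.1.
have sz f : suppQ T (zext T f) by exact: suppQ_zext.
have sB f1 f2 : suppQ T (fun z => zext T f1 z - zext T f2 z).
  by move=> z nQz; rewrite !zext_out// subrr.
have Htest g k : suppQ T g -> suppQ T k ->
    L2 leb2 g ->
    L2 leb2 k -> wdx g k ->
    \int[leb2]_z ((H1 z - H2 z) * g z) +
    \int[leb2]_z
      (k z * volt ltk (fun z => F1 z - F2 z) z) = 0.
  move=> sg sk ig ik gk.
  have tf := test_fun_volt sg sk ig ik gk.
  have E1 := weak_form_volt sg sk (sz _) ig ik iF1 (erefl H1) (erefl F1) (e1 _ _ _ tf).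
  have E2 := weak_form_volt sg sk (sz _) ig ik iF2 (erefl H2) (erefl F2) (e2 _ _ _ tf).
  rewrite (volt_subr (sz _) (sz _) sk iF1 iF2 ik).
  have -> : \int[leb2]_z ((H1 z - H2 z) * g z) =
      \int[leb2]_z (H1 z * g z) - \int[leb2]_z (H2 z * g z).
    rewrite -RintB; [|exact: L2M|exact: L2M].
    by apply: Rint_eq => z; rewrite mulrBl.
  (* Both solutions are tested with the same eta, so their initial-data terms coincide and subtract
     to zero. *)
  by rewrite addrACA -opprD E1 E2 subrr.
have E0 := @energy_uniqueness R T (fun z => H1 z - H2 z) (fun z => V1 z - V2 z)
  (fun z => X1 z - X2 z) (fun z => b1 z - b2 z) P (fun z => F1 z - F2 z) Ch Cb dl
  Ch0 Cb0 dl0 (sB _ _) (sB _ _) (sB _ _) (sz _) (sB _ _) (L2B iH1 iH2) (L2B iV1 iV2)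
  (L2B iX1 iX2) iP (L2B iF1 iF2) (measurable_funB mb1 mb2).
have {}E0 := E0 _ _ _ _ _ im Htest.
have w2 := (L2B iV1 iV2).2.
have diff_eq0 : \int[leb2]_z ((V1 z - V2 z) ^+ 2) = 0.
  apply: E0.
  - by move=> z; rewrite /F1 /F2 !FE -/b1 -/b2 -/X1 -/X2; ring.
  - move=> z; have [Qz|nQz] := asboolP (QT T z); last first.
      by rewrite /H1 /H2 /V1 /V2 !zext_out// subrr normr0 mulr0.
    rewrite /H1 /H2 /V1 /V2 /cu !zext_in//.
    by have [c ->] := mean_value dh (v1 z.1 z.2) (v2 z.1 z.2); rewrite normrM ler_wpM2r.
  - move=> z; have [Qz|nQz] := asboolP (QT T z); last first.
      by rewrite /b1 /b2 /V1 /V2 !zext_out// subrr normr0 mulr0.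
    rewrite /b1 /b2 /V1 /V2 /cu !zext_in//.
    have [c ->] := mean_value db (v1 z.1 z.2) (v2 z.1 z.2).
    by rewrite normrM ler_wpM2r//; have [_ []] := bbd c.
  - move=> z; have [Qz|nQz] := asboolP (QT T z); last first.
      by rewrite /H1 /H2 /V1 /V2 !zext_out// subrr expr0n mulr0.
    rewrite /H1 /H2 /V1 /V2 /cu !zext_in//.
    have [c ->] := mean_value dh (v1 z.1 z.2) (v2 z.1 z.2).
    by rewrite -mulrA -expr2 ler_wpM2r ?sqr_ge0//; have [/andP[]] := hbd c.
  - exact: (wdxB (sz _) (sz _) (sz _) (sz _) iV1 iV2 iX1 iX2 (wdx_zext wv1) (wdx_zext wv2)).
apply: (ae_imp (mu := leb2) (Rint_eq0_ae w2 (fun z => sqr_ge0 (V1 z - V2 z)) diff_eq0)).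
move=> z /eqP; rewrite sqrf_eq0 subr_eq0 => /eqP + Qz.
by rewrite /V1 /V2 !zext_in.
Qed.

End uniqueness_of_weak_solutions.

Theorem theorem2p3 (R : realType) (T : R) (h b : R -> R) (p : R -> R -> R)
    (v0 : R -> R) :
  0 < T -> A1 h -> A2 b -> L4_L2 T p -> L2_01 v0 ->
  forall v1 v2 : R -> R -> R,
    weak_solution T h b p v0 v1 -> weak_solution T h b p v0 v2 ->
    {ae ((@lebesgue_measure R) \x (@lebesgue_measure R))%E,
       forall z : R * R, QT T z -> v1 z.1 z.2 = v2 z.1 z.2}.
Proof. by move=> _ hA bA pL _; exact: weak_solution_unique hA bA pL. Qed.
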